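(* Let $n\ge0$, $\delta t>0$, and let $\{c_i^n\}_{i=1}^N\subset X_M$ be given. Consider the fully discrete Galerkin scheme: find $\{c_i^{n+1}\}_{i=1}^N\subset X_M$ and $\phi^{n+1}\in X_M$ with $$\Big[\frac{c_i^{n+1}-c_i^n}{\delta t},v\Big]=-\Big[D_ic_i^n\nabla\Big(I_M\big(\log c_i^{n+1}+z_i(\phi^{n+1}+\phi_e)\big)\Big),\nabla v\Big]\quad\forall v\in X_M,\ i=1,\dots,N,$$ $$(\epsilon\nabla\phi^{n+1},\nabla w)=\Big[\rho_0+\sum_{i=1}^Nz_ic_i^{n+1},w\Big]\quad\forall w\in X_M,$$ and $\int_\Omega\phi^{n+1}\,d\bm{x}=0$. Then: 1. (Mass conservation) Any solution satisfies $[c_i^{n+1},1]=[c_i^n,1]$ for all $i$. Moreover, if $c_i^n(\bm{z})>0$ for all $i$ and all $\bm{z}\in Z$, then: 2. (Unique solvability) The scheme possesses a unique solution $(\{c_i^{n+1}\},\phi^{n+1})$, with $c_i^{n+1}\in X_M$ and $\phi^{n+1}\in X_M$. 3. (Positivity) $c_i^{n+1}(\bm{z})>0$ for all $i$ and all $\bm{z}\in Z$. 4. (Energy dissipation) $$\tilde E^{n+1}-\tilde E^n\le-\delta t\sum_{i=1}^N\big[D_ic_i^n\nabla\mu_i^{n+1},\nabla\mu_i^{n+1}\big],$$ where $\mu_i^{n+1}=I_M\big(\log c_i^{n+1}+z_i(\phi^{n+1}+\phi_e)\big)$ and, for $k\in\{n,n+1\}$, $$\tilde E^k=\sum_{i=1}^N\big[c_i^k\log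 c_i^k-c_i^k,1\big]+\Big[\rho_0+\sum_{i=1}^Nz_ic_i^k,\ \frac12\phi^k+\phi_e\Big].$$
   Context: $\Omega\subset\mathbb{R}^d$ ($d=1,2,3$) is a bounded domain (open, connected). $N\ge1$; $z_i\in\mathbb{R}$, $D_i>0$, $\epsilon>0$, $\rho_0\in\mathbb{R}$ are constants; $\phi_e$ is a given continuous function (external potential). The scheme discretizes the Poisson--Nernst--Planck equations with homogeneous Neumann boundary conditions on the chemical potentials $\log c_i+z_i(\phi+\phi_e)$ and on $\phi$. $(\cdot,\cdot)$ is the $L^2(\Omega)$ inner product. $Z$ is a finite set of points of $\overline\Omega$ and $[\cdot,\cdot]$ is the discrete inner product (numerical integration) $$[u,v]=\sum_{\bm{z}\in Z}\beta_{\bm{z}}u(\bm{z})v(\bm{z}),\qquad\beta_{\bm{z}}>0,$$ with the dot product used for vector-valued arguments. For finite element methods the sum is read as $\sum_{K\in\mathcal T}\sum_{\bm{z}\in Z(K)}$ over the elements $K$ of a triangulation $\mathcal T$ and the quadrature points $Z(K)$ of $K$ (with positive weights), gradients at $\bm{z}\in Z(K)$ being taken from within $K$, and $Z=\bigcup_KZ(K)$. $X_M\subset H^1(\Omega)$ is a finite-dimensional space of continuous functions on $\overline\Omega$, whose gradients have well-defined values at the points of $Z$ (for finite element methods: whose gradients, taken from within $K$, have well-defined values at the quadrature points $\bm{z}\in Z(K)$ for every element $K\in\mathcal T$), and which contains the constants. For each $\bm{z}\in Z$ there is a unique $\psi_{\bm{z}}\in X_M$ with $\psi_{\bm{z}}(\bm{z}')=\delta_{\bm{z}\bm{z}'}$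 for all $\bm{z}'\in Z$ (so the $\psi_{\bm z}$ form a basis of $X_M$). $I_M$ is the interpolation operator onto $X_M$ at the points of $Z$: $I_Mf=\sum_{\bm{z}\in Z}f(\bm{z})\psi_{\bm{z}}$; it only uses values at the points of $Z$. A solution of the scheme is required to be such that $\log c_i^{n+1}(\bm{z})$ is defined for all $\bm{z}\in Z$. Standing assumptions: discrete electroneutrality $\big[\rho_0+\sum_iz_ic_i^n,1\big]=0$; and $\phi^n\in X_M$ is the potential associated with $\{c_i^n\}$, i.e. $(\epsilon\nabla\phi^n,\nabla w)=\big[\rho_0+\sum_iz_ic_i^n,w\big]$ for all $w\in X_M$ and $\int_\Omega\phi^n\,d\bm{x}=0$. *)

(* Defs.v *)
From HB Require Import structures.
From mathcomp Require Import all_boot all_order all_algebra.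
From mathcomp Require Import finmap.
From mathcomp Require Import all_classical all_reals all_analysis.

Set Implicit Arguments.
Unset Strict Implicit.
Unset Printing Implicit Defensive.
Import Order.TTheory GRing.Theory Num.Theory.
Import numFieldNormedType.Exports.

Local Open Scope classical_set_scope.
Local Open Scope ring_scope.

Definition rV_display : measure_display -> measure_display.
Proof. exact. Qed.

Section rV_measurable.
Context {R : realType}.
Variable n : nat.

Definition rV_coord (i : 'I_n) (x : 'rV[R]_n) : measurableTypeR R := x 0 i.

Let rV_set0 : g_sigma_preimage rV_coord set0.
Proof. exact: sigma_algebra0. Qed.

Let rV_setC A : g_sigma_preimage rV_coord A -> g_sigma_preimage rV_coord (~` A).
Proof. exact: sigma_algebraC. Qed.

Let rV_bigcup (F : (set 'rV[R]_n)^nat) :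
  (forall i, g_sigma_preimage rV_coord (F i)) ->
  g_sigma_preimage rV_coord (\bigcup_i (F i)).
Proof. exact: sigma_algebra_bigcup. Qed.

(* The Borel sigma-algebra of R^n, generated by the coordinate functions. *)
HB.instance Definition _ := @isMeasurable.Build (rV_display default_measure_display)
  'rV[R]_n (g_sigma_preimage rV_coord) rV_set0 rV_setC rV_bigcup.

End rV_measurable.

Section rV_measurable_fun.
Context {R : realType}.

Lemma measurable_rV_coord n (i : 'I_n) :
  measurable_fun [set: 'rV[R]_n] (@rV_coord R n i).
Proof.
move=> _ Y mY; rewrite setTI; apply: sub_sigma_algebra => /=.
rewrite -bigcup_seq/=; exists i => /=; first by rewrite mem_index_enum.
by exists Y => //; rewrite setTI.
Qed.

Lemma measurable_fun_rV d1 (T1 : measurableType d1) n (f : T1 -> 'rV[R]_n) :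
  (forall i, measurable_fun [set: T1] (@rV_coord R n i \o f)) ->
  measurable_fun [set: T1] f.
Proof.
move=> mf.
have sf : sigma_algebra [set: 'rV[R]_n]
    [set A : set 'rV[R]_n | measurable (f @^-1` A)].
  split=> /=.
  - by rewrite preimage_set0.
  - by move=> A mA; rewrite setTD preimage_setC; exact: measurableC.
  - by move=> F mF; rewrite preimage_bigcup; exact: bigcupT_measurable.
suff H : g_sigma_preimage (@rV_coord R n) `<=`
    [set A : set 'rV[R]_n | measurable (f @^-1` A)].
  by move=> _ Y mY; rewrite setTI; exact: H.
apply: smallest_sub => //.
case: n f mf {sf} => [|m] f mf; first by rewrite big_ord0.
rewrite -bigcup_mkord_ord; apply: bigcup_sub => i Ii _ [B mB <-] /=.
by rewrite setTI; have := mf (inord i) measurableT B mB; rewrite setTI.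
Qed.

Definition rV_cons n (p : measurableTypeR R * 'rV[R]_n) : 'rV[R]_n.+1 :=
  row_mx (p.1 : R)%:M p.2.

Definition rV_uncons n (x : 'rV[R]_n.+1) : measurableTypeR R * 'rV[R]_n :=
  (x 0 ord0, \row_j x 0 (lift ord0 j)).

Lemma rV_consE0 n p : @rV_cons n p 0 ord0 = p.1.
Proof.
rewrite /rV_cons -[ord0](_ : lshift n (@ord0 0) = _); last exact/val_inj.
by rewrite (@row_mxEl _ 1 1 n) mxE eqxx mulr1n.
Qed.

Lemma rV_consES n p j : @rV_cons n p 0 (lift ord0 j) = p.2 0 j.
Proof.
rewrite /rV_cons -[lift _ _](_ : rshift 1 j = _); last exact/val_inj.
by rewrite (@row_mxEr _ 1 1 n).
Qed.

Lemma rV_consK n : cancel (@rV_cons n) (@rV_uncons n).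
Proof.
move=> p; rewrite /rV_uncons rV_consE0 [RHS]surjective_pairing; congr pair.
by apply/rowP => j; rewrite mxE rV_consES.
Qed.

Lemma rV_unconsK n : cancel (@rV_uncons n) (@rV_cons n).
Proof.
move=> x; apply/rowP => i; case: (unliftP ord0 i) => [j|] ->.
  by rewrite rV_consES mxE.
by rewrite rV_consE0.
Qed.

Lemma measurable_rV_cons n : measurable_fun setT (@rV_cons n).
Proof.
apply: measurable_fun_rV => i; case: (unliftP ord0 i) => [j|] ->.
  rewrite [X in measurable_fun _ X](_ : _ = @rV_coord R n j \o snd); last first.
    by apply/funext => p /=; rewrite /rV_coord rV_consES.
  exact: measurableT_comp (@measurable_rV_coord n j) measurable_snd.
rewrite [X in measurable_fun _ X](_ : _ = fst)//.
by apply/funext => p /=; rewrite /rV_coord rV_consE0.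
Qed.

Lemma measurable_rV_uncons n : measurable_fun setT (@rV_uncons n).
Proof.
apply/measurable_fun_pairP; split; first exact: (@measurable_rV_coord n.+1 ord0).
apply: measurable_fun_rV => j.
rewrite [X in measurable_fun _ X](_ : _ = @rV_coord R n.+1 (lift ord0 j)).
  exact: measurable_rV_coord.
by apply/funext => x /=; rewrite /rV_coord mxE.
Qed.

End rV_measurable_fun.

Section lebesgue_rV_step.
Context {R : realType}.
Variables (n : nat) (m : {sigma_finite_measure set 'rV[R]_n -> \bar R}).

Definition lebesgue_step : set 'rV[R]_n.+1 -> \bar R :=
  pushforward (@lebesgue_measure R \x m)%E (@rV_cons R n).

Let step0 : lebesgue_step set0 = 0%E.
Proof. by rewrite /lebesgue_step /pushforward preimage_set0 measure0. Qed.

Let step_ge0 A : (0 <= lebesgue_step A)%E.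
Proof. by rewrite /lebesgue_step /pushforward; apply: measure_ge0. Qed.

Let step_sigma_additive : semi_sigma_additive lebesgue_step.
Proof.
move=> F mF tF mUF; rewrite /lebesgue_step /pushforward preimage_bigcup.
apply: measure_semi_sigma_additive.
- by move=> k; rewrite -[X in measurable X]setTI; exact: measurable_rV_cons.
- apply/trivIsetP => /= i j _ _ ij; rewrite -preimage_setI.
  by move/trivIsetP : tF => /(_ _ _ _ _ ij) ->//; rewrite preimage_set0.
- rewrite -preimage_bigcup -[X in measurable X]setTI.
  exact: measurable_rV_cons.
Qed.

HB.instance Definition _ :=
  isMeasure.Build _ _ _ lebesgue_step step0 step_ge0 step_sigma_additive.

Let step_sigma_finite : sigma_finite setT lebesgue_step.
Proof.
have /sigma_finiteP[F [TF ndF Foo]] := sigma_finiteT (@lebesgue_measure R).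
have /sigma_finiteP[G [TG ndG Goo]] := sigma_finiteT m.
exists (fun k => @rV_uncons R n @^-1` (F k `*` G k)).
  apply/esym; rewrite -subTset => x _.
  have [i _ Fi] : (\bigcup_i F i) (@rV_uncons R n x).1 by rewrite -TF.
  have [j _ Gj] : (\bigcup_j G j) (@rV_uncons R n x).2 by rewrite -TG.
  exists (maxn i j) => //; split.
  - by move: Fi; exact/subsetPset/ndF/leq_maxl.
  - by move: Gj; exact/subsetPset/ndG/leq_maxr.
move=> k; have [mF Fk] := Foo k; have [mG Gk] := Goo k; split.
  rewrite -[X in measurable X]setTI.
  by apply: measurable_rV_uncons => //; exact: measurableX.
rewrite /lebesgue_step /pushforward -comp_preimage.
rewrite (_ : _ @^-1` _ = F k `*` G k).
  by rewrite product_measure1E// lte_mul_pinfty// ge0_fin_numE.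
rewrite (_ : _ \o _ = id) ?preimage_id//.
by apply/funext => p; exact: rV_consK.
Qed.

HB.instance Definition _ :=
  Measure_isSigmaFinite.Build _ _ _ lebesgue_step step_sigma_finite.

End lebesgue_rV_step.

(* d-dimensional Lebesgue measure: the d-fold product of [lebesgue_measure],
   carried over to row vectors. *)
Fixpoint lebesgue_rV {R : realType} (d : nat) :
    {sigma_finite_measure set 'rV[R]_d -> \bar R} :=
  if d is n.+1 then lebesgue_step (lebesgue_rV n) else \d_(0 : 'rV[R]_0).

Section sobolev.
Context {R : realType} {d : nat}.
Implicit Types (Omega : set 'rV[R]_d) (u : 'rV[R]_d -> R).

Definition dotv (v w : 'rV[R]_d) : R := \sum_j v 0 j * w 0 j.

Definition bounded_domain Omega : Prop :=
  [/\ open Omega, connected Omega, Omega !=set0 & bounded_set Omega].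

Fixpoint Ck (k : nat) (f : 'rV[R]_d -> R) : Prop :=
  continuous f /\
  if k is k'.+1 then
    forall j : 'I_d, (forall x, derivable f x (delta_mx 0 j)) /\
                     Ck k' (fun x => 'D_(delta_mx 0 j) f x)
  else True.

(* C_c^oo(Omega) *)
Definition test_function Omega (f : 'rV[R]_d -> R) : Prop :=
  let supp := closure [set x | f x != 0] in
  [/\ forall k, Ck k f, compact supp & supp `<=` Omega].

Definition L2 Omega u : Prop :=
  measurable_fun Omega u /\
  (lebesgue_rV d).-integrable Omega (fun x => (u x ^+ 2)%:E).

Definition is_weak_grad Omega u (g : 'rV[R]_d -> 'rV[R]_d) : Prop :=
  (forall j, L2 Omega (fun x => g x 0 j)) /\
  forall f, test_function Omega f -> forall j : 'I_d,
    \int[lebesgue_rV d]_(x in Omega) (u x * 'D_(delta_mx 0 j) f x) =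
    - \int[lebesgue_rV d]_(x in Omega) (g x 0 j * f x).

Definition H1 Omega u : Prop := L2 Omega u /\ exists g, is_weak_grad Omega u g.

(* A representative of the (a.e. unique) weak gradient. *)
Definition weak_grad Omega u : 'rV[R]_d -> 'rV[R]_d :=
  xget (fun=> 0) [set g | is_weak_grad Omega u g].

Definition L2_inner Omega (g h : 'rV[R]_d -> 'rV[R]_d) : R :=
  \int[lebesgue_rV d]_(x in Omega) dotv (g x) (h x).

(* [g] is the derivative at [z] of the restriction of [u] to [K]: the usual
   gradient at an interior point of [K], the one-sided one on its boundary. *)
Definition is_grad_within (K : set 'rV[R]_d) (z : 'rV[R]_d) u (g : 'rV[R]_d)
    : Prop :=
  (u x - u z - dotv g (x - z)) / `|x - z| @[x --> within K z^'] --> (0 : R).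

End sobolev.

(* A subdivision of the closed domain into cells, each with its quadrature nodes
   and weights. A global rule, with no underlying triangulation, is the case of
   the single cell [closure Omega]. A node shared by several cells contributes
   once per cell, with that cell's weight and gradient. *)
Record quadrature (R : realType) (d : nat) (Omega : set 'rV[R]_d) := Quadrature {
  elem : finType;
  cell : elem -> set 'rV[R]_d;
  nodes : elem -> {fset 'rV[R]_d};
  weight : elem -> 'rV[R]_d -> R;
  cell_closed : forall e, closed (cell e);
  cell_cover : \bigcup_e cell e = closure Omega;
  cell_disjoint : forall e e', e != e' ->
    interior (cell e) `&` interior (cell e') = set0;
  nodes_cell : forall e z, z \in nodes e -> cell e z;
  nodes_neq0 : exists e z, z \in nodes e;
  weight_gt0 : forall e z, z \in nodes e -> 0 < weight e z
}.

Section scheme.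
Context {R : realType} {d : nat} {Omega : set 'rV[R]_d}.
Variables (Q : quadrature Omega) (X : set ('rV[R]_d -> R)).
Implicit Types (u v w f psi phi : 'rV[R]_d -> R).

Definition nodeset : {fset 'rV[R]_d} := (\bigcup_(e in elem Q) nodes e)%fset.

Definition disc_inner u v : R :=
  \sum_(e : elem Q) \sum_(z <- nodes e) weight e z * (u z * v z).

Definition disc_innerv (g h : elem Q -> 'rV[R]_d -> 'rV[R]_d) : R :=
  \sum_(e : elem Q) \sum_(z <- nodes e) weight e z * dotv (g e z) (h e z).

Definition disc_grad u (e : elem Q) (z : 'rV[R]_d) : 'rV[R]_d :=
  xget 0 [set g | is_grad_within (cell e) z u g].

Definition is_nodal (z : 'rV[R]_d) psi : Prop :=
  X psi /\ forall z', z' \in nodeset -> psi z' = (z == z')%:R.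

(* A function on [closure Omega] is represented by any extension of it to R^d;
   only values on [closure Omega] are ever compared. *)
Record galerkin_space : Prop := GalerkinSpace {
  gs_lin : forall a u v, X u -> X v -> X (fun x => a * u x + v x);
  gs_cst : forall a, X (fun=> a);
  gs_findim : exists m (b : 'I_m -> 'rV[R]_d -> R), (forall k, X (b k)) /\
    forall u, X u -> exists a : 'I_m -> R,
      {in closure Omega, forall x, u x = \sum_k a k * b k x};
  gs_cont : forall u, X u -> {within closure Omega, continuous u};
  gs_H1 : forall u, X u -> H1 Omega u;
  gs_grad : forall u, X u -> forall (e : elem Q) z, z \in nodes e ->
    exists! g, is_grad_within (cell e) z u g;
  gs_nodal : forall z, z \in nodeset -> exists psi, is_nodal z psi /\
    forall psi', is_nodal z psi' -> {in closure Omega, psi =1 psi'}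
}.

Definition nodal_basis (z : 'rV[R]_d) : 'rV[R]_d -> R :=
  xget (fun=> 0) [set psi | is_nodal z psi].

Definition interp f : 'rV[R]_d -> R :=
  fun x => \sum_(z <- nodeset) f z * nodal_basis z x.

Section pnp.
Variables (N : nat) (zeta D : 'I_N -> R) (eps rho0 : R).
Variable phie : 'rV[R]_d -> R.
Implicit Types c : 'I_N -> 'rV[R]_d -> R.

Definition charge_density c : 'rV[R]_d -> R :=
  fun x => rho0 + \sum_i zeta i * c i x.

Definition is_potential c phi : Prop :=
  [/\ X phi,
      forall w, X w ->
        L2_inner Omega (fun x => eps *: weak_grad Omega phi x)
                       (weak_grad Omega w) =
        disc_inner (charge_density c) w
    & \int[lebesgue_rV d]_(x in Omega) phi x = 0].

Definition chem_potential c phi (i : 'I_N) : 'rV[R]_d -> R :=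
  interp (fun x => ln (c i x) + zeta i * (phi x + phie x)).

(* [ln] is total, so the domain of the logarithm has to be enforced. *)
Definition log_defined (t : R) : Prop := exists s, expR s = t.

Record is_solution (dt : R) (cn c : 'I_N -> 'rV[R]_d -> R) (phi : 'rV[R]_d -> R)
    : Prop := IsSolution {
  sol_space : forall i, X (c i);
  sol_log : forall i z, z \in nodeset -> log_defined (c i z);
  sol_transport : forall v, X v -> forall i,
    disc_inner (fun x => (c i x - cn i x) / dt) v =
    - disc_innerv
        (fun e z => (D i * cn i z) *: disc_grad (chem_potential c phi i) e z)
        (disc_grad v);
  sol_potential : is_potential c phi
}.

Definition energy c phi : R :=
  \sum_i disc_inner (fun x => c i x * ln (c i x) - c i x) (fun=> 1) +
  disc_inner (charge_density c) (fun x => 2^-1 * phi x + phie x).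

Definition dissipation (cn c : 'I_N -> 'rV[R]_d -> R) phi : R :=
  \sum_i disc_innerv
    (fun e z => (D i * cn i z) *: disc_grad (chem_potential c phi i) e z)
    (disc_grad (chem_potential c phi i)).

End pnp.
End scheme.

(* Main.v *)
Require Import Defs.
From HB Require Import structures.
From mathcomp Require Import all_boot all_order all_algebra.
From mathcomp Require Import finmap.
From mathcomp Require Import all_classical all_reals all_analysis.
From mathcomp Require Import ring lra measurable_realfun.
Import Order.TTheory GRing.Theory Num.Theory.
Import numFieldNormedType.Exports.
Local Open Scope classical_set_scope.
Local Open Scope ring_scope.

Set Implicit Arguments.
Unset Strict Implicit.
Unset Printing Implicit Defensive.

(** The transport equation is the Euler-Lagrange equation, in the unknown
    chemical potentials mu_i and potential phi, of the functional
      sum_i ([exp (mu_i - z_i (phi + phi_e)), 1] - [c_i^n, mu_i]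
             + (dt/2) A_i(mu_i, mu_i)) + (eps/2) |grad phi|^2 - [rho_0, phi],
    where A_i(u, v) = [D_i c_i^n grad u, grad v], while stationarity in phi is the
    Poisson equation. Since phi^n solves the Poisson equation at time n, with
    nu_i = mu_i - z_i (phi + phi_e) this functional is, up to a constant,
      sum_i ([exp nu_i - c_i^n nu_i, 1] + (dt/2) A_i(mu_i, mu_i))
        + (eps/2) |grad (phi - phi^n)|^2,
    which is coercive because c_i^n > 0, once the mean of phi is penalized.
    Its minimizer is a solution, positive as an exponential. Uniqueness follows by
    subtracting two solutions and testing with the difference of the chemical
    potentials; energy dissipation by testing with mu_i and using that
    t ln t - t is convex and the Dirichlet form nonnegative.

    The Dirichlet form is defined from arbitrarily chosen weak gradients. Its
    bilinearity rests on their uniqueness almost everywhere, and its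
    definiteness modulo constants on the fact that a continuous function with
    zero weak gradient on a connected open set is constant. *)

(** * Boxes and Lebesgue measure on row vectors *)

(** With chemical potentials as unknowns the constraint c_i > 0 disappears, and the minimization
    runs over a whole vector space. The price is a degeneracy: adding a constant to the potential
    and z_i times it to every mu_i changes neither the concentrations nor any gradient. The squared
    mean breaks this invariance; stationarity along that same direction, where all other terms are
    constant, forces the mean to vanish. The analysis avoids mollification. Products of the profiles
    exp(-1/t) give bumps on boxes, and boxes are a pi-system generating the Borel sets, so integrals
    vanishing on boxes vanish on all measurable subsets. A function with zero weak gradient is
    compared at two points through a test function whose derivative is the difference of two
    translates of one bump; continuity turns the resulting integral identity into a pointwise
    inequality. *)

Section boxes.
Context {R : realType} {n : nat}.
Implicit Types (a b x : 'rV[R]_n).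

Definition box a b : set 'rV[R]_n := [set x | forall i, a 0 i < x 0 i < b 0 i].

Definition cbox a b : set 'rV[R]_n := [set x | forall i, a 0 i <= x 0 i <= b 0 i].

Lemma box_cbox a b : box a b `<=` cbox a b.
Proof. by move=> x xab i; have /andP[/ltW-> /ltW->] := xab i. Qed.

Lemma boxI a b a' b' :
  box a b `&` box a' b' =
  box (\row_i Num.max (a 0 i) (a' 0 i)) (\row_i Num.min (b 0 i) (b' 0 i)).
Proof.
apply/seteqP; split => x /=.
  move=> [h h'] i; rewrite !mxE gt_max lt_min.
  by have /andP[-> ->] := h i; have /andP[-> ->] := h' i.
by move=> h; split=> i; have := h i; rewrite !mxE gt_max lt_min;
  move=> /andP[/andP[? ?] /andP[? ?]]; apply/andP.
Qed.

Lemma setI_closed_box : setI_closed [set A | exists a b, A = box a b].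
Proof. by move=> _ _ [a [b ->]] [a' [b' ->]]; rewrite boxI; do 2 eexists. Qed.

Lemma box_ball x (e : R) : 0 < e -> ball x e = box (x - const_mx e) (x + const_mx e).
Proof.
move=> e0; apply/seteqP; split => y /=.
  move=> [_ h] i; have := h 0 i; rewrite /ball/= !mxE.
  by rewrite ltr_norml => /andP[? ?]; apply/andP; split; lra.
move=> h; split=> // i j; rewrite ord1; have := h j; rewrite !mxE => /andP[? ?].
by rewrite /ball/= ltr_norml; apply/andP; split; lra.
Qed.

Lemma open_box a b : open (box a b).
Proof.
rewrite openE => x xab.
have : \forall y \near x, forall i, a 0 i < (y : 'rV[R]_n) 0 i < b 0 i.
  have := @filter_forall 'rV[R]_n 'I_n
    (fun i y => a 0 i < (y : 'rV[R]_n) 0 i < b 0 i) (nbhs x) _.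
  apply=> i; have /andP[ax xb] := xab i.
  apply: (@coord_continuous R 1 n 0 i x [set t | a 0 i < t < b 0 i]).
  near=> t; apply/andP; split; near: t; [exact: lt_nbhsr|exact: lt_nbhsl].
by [].
Unshelve. all: by end_near. Qed.

(** Rational corners make the family countable. The closed boxes are kept inside [U] so that bumps
    on them are test functions on [U]. *)
Lemma open_bigcup_box (U : set 'rV[R]_n) : open U ->
  exists (D : set nat) (p q : nat -> 'rV[R]_n),
    (forall k, D k -> cbox (p k) (q k) `<=` U) /\
    U = \bigcup_(k in D) box (p k) (q k).
Proof.
move=> oU.
pose rbox (r : 'rV[rat]_n * 'rV[rat]_n) : set 'rV[R]_n :=
  cbox (map_mx ratr r.1) (map_mx ratr r.2).
(* The default pair for numbers that code nothing is harmless: the index set chosen next only keeps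
   boxes contained in [U]. *)
pose G k : 'rV[rat]_n * 'rV[rat]_n := odflt (0, 0) (choice.unpickle k).
exists [set k | rbox (G k) `<=` U].
exists (fun k => map_mx ratr (G k).1), (fun k => map_mx ratr (G k).2); split => //.
apply/seteqP; split => x; last by move=> [k kU /box_cbox]; exact: kU.
move=> Ux; have [e /= e0 eU] := (nbhs_ballP _ _).1 (open_nbhs_nbhs (conj oU Ux)).
have lo (i : 'I_n) : {q : rat | ratr q \in `](x 0 i - e), (x 0 i)[}.
  apply: cid; have [|q] := @rat_in_itvoo _ (x 0 i - e) (x 0 i); first lra.
  by exists q.
have hi (i : 'I_n) : {q : rat | ratr q \in `](x 0 i), (x 0 i + e)[}.
  apply: cid; have [|q] := @rat_in_itvoo _ (x 0 i) (x 0 i + e); first lra.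
  by exists q.
pose r := (\row_i sval (lo i), \row_i sval (hi i)).
exists (choice.pickle r); last first.
  move=> i; rewrite /G choice.pickleK/=.
  rewrite !mxE; case: (lo i) => p /=; case: (hi i) => q /=.
  by rewrite !in_itv/= => /andP[-> _] /andP[_ ->].
rewrite /= /G choice.pickleK/= => y yr; apply: eU; rewrite box_ball// => i.
have := yr i; rewrite !mxE.
case: (lo i) => p /=; case: (hi i) => q /=; rewrite !in_itv/=.
move=> /andP[_ h1] /andP[h2 _] /andP[h3 h4].
by rewrite (lt_le_trans h2 h3) (le_lt_trans h4 h1).
Qed.

(** Boxes are stable under intersection, so this generation statement opens the way to Dynkin
    induction on measurable sets. *)
Lemma measurable_rV_box : @measurable _ 'rV[R]_n = <<s [set A | exists a b, A = box a b] >>.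
Proof.
have sbox : forall A, <<s [set A | exists a b, A = box a b] >> A -> measurable A.
  apply: smallest_sub; first exact: sigma_algebra_measurable.
  move=> _ [a [b ->]].
  rewrite (_ : box a b = \bigcap_(i in [set: 'I_n])
      (@rV_coord R n i @^-1` `]a 0 i, b 0 i[)).
    apply: fin_bigcap_measurable => // i _.
    by rewrite -[X in measurable X]setTI; exact: measurable_rV_coord.
  by apply/seteqP; split => x h i; have := h i; rewrite /rV_coord/= in_itv/=; exact.
apply/seteqP; split => A //; last exact: sbox.
apply: smallest_sub; first exact: smallest_sigma_algebra.
move=> B; rewrite -bigcup_seq => -[i _ [C mC <-]] {B}; rewrite setTI.
rewrite RGenOpens.measurableE in mC.
move: C mC; apply: smallest_sub => [|_ [x [y ->]]].
  split=> [|C sC|F sF].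
  - by rewrite /= preimage_set0; exact: sigma_algebra0.
  - by rewrite /= setTD preimage_setC; exact: sigma_algebraC.
  - by rewrite /= preimage_bigcup; exact: sigma_algebra_bigcup.
(* The preimage of an open interval under a coordinate is open, hence a countable union of boxes. *)
have /open_bigcup_box[D [p [q [_ ->]]]] : open (@rV_coord R n i @^-1` `]x, y[).
  by apply: open_comp => // z _; exact: coord_continuous.
rewrite bigcup_mkcond; apply: sigma_algebra_bigcup => k.
case: ifPn => _; last exact: sigma_algebra0.
by apply: sub_sigma_algebra; do 2 eexists.
Qed.

Lemma open_rV_measurable (U : set 'rV[R]_n) : open U -> measurable U.
Proof.
move=> oU; rewrite measurable_rV_box.
have [D [p [q [_ ->]]]] := open_bigcup_box oU.
rewrite bigcup_mkcond; apply: sigma_algebra_bigcup => k.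
case: ifPn => _; last exact: sigma_algebra0.
by apply: sub_sigma_algebra; do 2 eexists.
Qed.

Lemma measurable_box a b : measurable (box a b).
Proof. by apply: open_rV_measurable; exact: open_box. Qed.

Lemma within_continuous_rV_measurable (D : set 'rV[R]_n) (f : 'rV[R]_n -> R) :
  measurable D -> {within D, continuous f} -> measurable_fun D f.
Proof.
move=> mD /continuousP cf; apply: (measurability _ (RGenOpens.measurableE R)).
move=> _ [_ [x [y ->]] <-].
have /open_subspaceP[V oV VD] := cf _ (@interval_open R (BRight x) (BLeft y) isT isT).
by rewrite setIC -VD; apply: measurableI => //; exact: open_rV_measurable.
Qed.

Lemma continuous_rV_measurable (f : 'rV[R]_n -> R) :
  continuous f -> measurable_fun setT f.
Proof.
by move=> cf; apply: within_continuous_rV_measurable => //; exact: continuous_subspaceT.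
Qed.

End boxes.

Lemma lebesgue_rV_box {R : realType} n (a b : 'rV[R]_n) :
  (forall i, a 0 i <= b 0 i) ->
  lebesgue_rV n (box a b) = (\prod_i (b 0 i - a 0 i))%:E.
Proof.
elim: n a b => [|n IHn] a b ab.
  rewrite big_ord0 /= /dirac indicE mem_set// => i; by case: i.
rewrite /= /lebesgue_step /pushforward.
pose t (x : 'rV[R]_n.+1) : 'rV[R]_n := \row_j x 0 (lift ord0 j).
rewrite (_ : _ @^-1` _ = `]a 0 ord0, b 0 ord0[ `*` box (t a) (t b)); last first.
  apply/seteqP; split => p /=; rewrite in_itv/=.
    move=> h; split; first by have := h ord0; rewrite rV_consE0.
    by move=> j; have := h (lift ord0 j); rewrite rV_consES !mxE.
  move=> [h1 h2] i; case: (unliftP ord0 i) => [j|] ->.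
    by rewrite rV_consES; have := h2 j; rewrite !mxE.
  by rewrite rV_consE0.
rewrite product_measure1E//; last exact: measurable_box.
rewrite big_ord_recl EFinM; congr (_ * _)%E.
  transitivity (@lebesgue_measure R `]a 0 ord0, b 0 ord0[%classic) => //.
  rewrite lebesgue_measure_itv/= lte_fin -EFinB.
  case: ltP => // ba; congr EFin; apply/esym/eqP; rewrite subr_eq0.
  by rewrite eq_le ba ab.
rewrite IHn => [|i]; last by rewrite !mxE.
by congr (_%:E); apply: eq_bigr => i _; rewrite !mxE.
Qed.

(** * Smooth bump functions *)

Section flat.
Context {R : realType}.
Implicit Types (p : {poly R}) (x : R).

(* This family is stable under derivation, hence consists of smooth functions. *)
Definition flat p x : R := if 0 < x then p.[x^-1] * expR (- x^-1) else 0.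

(** With y = 1/x this is y^(k+1) / (k+1)! <= exp y. The linear decay at 0 is what differentiability
    there requires. *)
Lemma flat_Xn_bound k x : `|flat 'X^k x| <= k.+1`!%:R * `|x|.
Proof.
rewrite /flat; case: ifPn => x0; last by rewrite normr0 mulr_ge0.
have y0 : 0 < x^-1 by rewrite invr_gt0.
have x0n := lt0r_neq0 x0; have y0n := lt0r_neq0 y0.
rewrite hornerXn ger0_norm; last by rewrite mulr_ge0 ?expR_ge0// exprn_ge0// ltW.
rewrite gtr0_norm// expRN ler_pdivrMr ?expR_gt0// -(ler_pM2r y0) -exprSr.
have -> : k.+1`!%:R * x * expR x^-1 * x^-1 = k.+1`!%:R * expR x^-1 by field.
rewrite -ler_pdivrMl ?ltr0n ?fact_gt0// mulrC.
by apply: le_trans (expR_ge1Dxn k (ltW y0)); rewrite lerDr.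
Qed.

Lemma flatZ a p x : flat (a *: p) x = a * flat p x.
Proof. by rewrite /flat; case: ifPn => _; rewrite ?mulr0// hornerZ mulrA. Qed.

Lemma flat_bound p : exists2 C : R, 0 <= C & forall x, `|flat p x| <= C * `|x|.
Proof.
exists (\sum_(k < size p) `|p`_k| * k.+1`!%:R) => [|x].
  by apply: sumr_ge0 => k _; rewrite mulr_ge0.
have -> : flat p x = \sum_(k < size p) p`_k * flat 'X^k x.
  rewrite /flat; case: ifPn => x0; last by rewrite big1// => k _; rewrite mulr0.
  rewrite horner_coef mulr_suml; apply: eq_bigr => k _.
  by rewrite hornerXn mulrA.
rewrite (le_trans (ler_norm_sum _ _ _))// mulr_suml ler_sum// => k _.
by rewrite normrM -mulrA ler_wpM2l// flat_Xn_bound.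
Qed.

(** For x > 0 and y = 1/x, the derivative of p(y) exp(-y) in x is y^2 (p(y) - p'(y)) exp(-y), again
    of the same form. *)
Lemma is_derive_flat p x : is_derive x 1 (flat p) (flat ('X^2 * (p - p^`())) x).
Proof.
have [x0|x0|->] := ltgtP x 0.
- have -> : flat ('X^2 * (p - p^`())) x = 0 by rewrite /flat ltNge (ltW x0).
  apply: (@near_eq_is_derive R R R (cst 0)).
  near=> y; rewrite /flat ltNge ltW//=; near: y; exact: lt_nbhsl.
- have x0' : x != 0 by rewrite lt0r_neq0.
  apply: (@near_eq_is_derive R R R (fun y : R => p.[y^-1] * expR (- y^-1))).
    by near=> y; rewrite /flat ifT//; near: y; exact: lt_nbhsr.
  have dV : is_derive x (1 : R) (fun y : R => y^-1) (- x ^- 2).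
    by have := @is_deriveV R id x 1 1 x0' _; rewrite [_ *: 1]mulr1; exact.
  have dN : is_derive x (1 : R) (fun y : R => - y^-1) (x ^- 2).
    by rewrite -[X in is_derive _ _ _ X]opprK; exact: (is_deriveN dV).
  have de : is_derive x (1 : R) (fun y : R => expR (- y^-1)) (expR (- x^-1) * x ^- 2).
    exact: (@is_derive1_comp R expR (fun y => - y^-1)).
  have dp : is_derive x (1 : R) (fun y : R => p.[y^-1]) (p^`().[x^-1] * - x ^- 2).
    exact: (@is_derive1_comp R (horner p) (fun y => y^-1)).
  have := is_deriveM dp de.
  congr (is_derive _ _ _ _); rewrite /flat x0 !hornerE exprVn.
  by rewrite /GRing.scale/=; ring.
- have -> : flat ('X^2 * (p - p^`())) 0 = 0 by rewrite /flat ltxx.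
  (* Dividing [flat p h] by h multiplies the polynomial by X, so the difference quotient at 0 is
     again flat and is bounded by C|h|. *)
  have [C C0 hC] := flat_bound ('X * p).
  have C1 : 0 < C + 1 by rewrite ltr_wpDl.
  have df : h^-1 *: ((flat p \o shift 0) (h *: 1) - flat p 0) @[h --> (0:R)^'] --> (0 : R).
    apply/cvgrPdist_lt => /= e e0; near=> h.
    have hn0 : h != 0 by near: h; exact: nbhs_dnbhs_neq.
    rewrite sub0r normrN /= [_ *: 1]mulr1 addr0 /flat ltxx subr0.
    have -> : h^-1 *: (if 0 < h then p.[h^-1] * expR (- h^-1) else 0) = flat ('X * p) h.
      rewrite /flat; case: ifPn => _; last by rewrite scaler0.
      by rewrite hornerM hornerX -mulrA.
    rewrite (le_lt_trans (hC h))//.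
    have : `|h| < e / (C + 1).
      by near: h; apply: dnbhs0_lt; apply: divr_gt0.
    rewrite ltr_pdivlMr// => /(le_lt_trans _); apply.
    by rewrite mulrC ler_wpM2l// lerDl.
  by apply: DeriveDef; [apply/cvg_ex; exists 0|exact: cvg_lim].
Unshelve. all: by end_near. Qed.

End flat.

(** * Functions of class C^k *)

Section Ck_theory.
Context {R : realType} {d : nat}.
Implicit Types (f g : 'rV[R]_d -> R) (k : nat) (i j : 'I_d).

Lemma Ck_continuous k f : Ck k f -> continuous f.
Proof. by case: k => [|k] []. Qed.

Lemma CkS k f : Ck k.+1 f -> Ck k f.
Proof.
elim: k f => [|k IHk] f; first by case.
by move=> [cf Df]; split => // j; have [? ?] := Df j; split => //; exact: IHk.
Qed.

Lemma Ck_cst k (c : R) : Ck k (fun _ : 'rV[R]_d => c).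
Proof.
have cc : continuous (fun _ : 'rV[R]_d => c) by exact: cst_continuous.
elim: k c cc => [|k IHk] c cc; first by split.
split=> // j; split=> [x|]; first exact: derivable_cst.
rewrite (_ : 'D_(delta_mx 0 j) _ = fun=> 0); last first.
  by apply/funext => x; exact: derive_cst.
by apply: IHk; exact: cst_continuous.
Qed.

Lemma CkD k f g : Ck k f -> Ck k g -> Ck k (fun x => f x + g x).
Proof.
elim: k f g => [|k IHk] f g [cf Df] [cg Dg].
  by split => // x; exact: (continuousD (cf x) (cg x)).
split=> [x|j]; first by exact: (continuousD (cf x) (cg x)).
have [df Cf] := Df j; have [dg Cg] := Dg j.
split=> [x|]; first by apply: derivableD.
rewrite (_ : 'D_(delta_mx 0 j) _ = fun x => 'D_(delta_mx 0 j) f x + 'D_(delta_mx 0 j) g x).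
  exact: IHk.
by apply/funext => x; apply: deriveD.
Qed.

Lemma CkM k f g : Ck k f -> Ck k g -> Ck k (fun x => f x * g x).
Proof.
elim: k f g => [|k IHk] f g Cf' Cg'.
  case: Cf' Cg' => [cf _] [cg _].
  by split => // x; exact: (continuousM (cf x) (cg x)).
have [[cf Df] [cg Dg]] := (Cf', Cg').
split=> [x|j]; first by exact: (continuousM (cf x) (cg x)).
have [df Cf] := Df j; have [dg Cg] := Dg j.
split=> [x|]; first by apply: derivableM.
rewrite (_ : 'D_(delta_mx 0 j) _ =
    fun x => f x * 'D_(delta_mx 0 j) g x + g x * 'D_(delta_mx 0 j) f x).
  by apply: CkD; apply: IHk => //; exact: CkS.
by apply/funext => x; apply: deriveM.
Qed.

Lemma Ck_prod k (I : Type) (s : seq I) (F : I -> 'rV[R]_d -> R) :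
  (forall i : I, Ck k (F i)) -> Ck k (fun x => \prod_(i <- s) F i x).
Proof.
move=> CF; elim: s => [|i s IHs].
  rewrite (_ : (fun x => _) = fun=> 1); first exact: Ck_cst.
  by apply/funext => x; rewrite big_nil.
rewrite (_ : (fun x => _) = fun x => F i x * \prod_(i <- s) F i x); first exact: CkM.
by apply/funext => x; rewrite big_cons.
Qed.

Lemma derive_coord (h : R -> R) i j (x : 'rV[R]_d) :
  (fun t : R => t^-1 *: (((fun y : 'rV[R]_d => h (y 0 i)) \o shift x)
    (t *: delta_mx 0 j) - h (x 0 i))) =
  (fun t : R => t^-1 *: ((h \o shift (x 0 i)) (t *: ((i == j)%:R : R)) - h (x 0 i))).
Proof. by apply/funext => t /=; rewrite !mxE eqxx. Qed.

Lemma is_derive_coord (h : R -> R) (h' : R) i j (x : 'rV[R]_d) :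
  is_derive (x 0 i) (1 : R) h h' ->
  is_derive x (delta_mx 0 j) (fun y : 'rV[R]_d => h (y 0 i)) ((i == j)%:R * h').
Proof.
move=> hh'; have {hh'} : is_derive (x 0 i) ((i == j)%:R : R) h ((i == j)%:R * h').
  case: eqP => _; rewrite ?mul1r// mul0r.
  by split; [exact: derivable0|exact: derive0].
move=> [dh Dh]; split; first by rewrite /derivable derive_coord.
by rewrite -Dh /derive derive_coord.
Qed.

Lemma Ck_coordS k (h h' : R -> R) i : (forall x : R, is_derive x (1 : R) h (h' x)) ->
  Ck k (fun x : 'rV[R]_d => h' (x 0 i)) -> Ck k.+1 (fun x : 'rV[R]_d => h (x 0 i)).
Proof.
move=> hh' Ch'; split=> [x|j].
  apply: (@continuous_comp _ _ _ (fun x : 'rV[R]_d => x 0 i) h).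
    exact: coord_continuous.
  by apply: differentiable_continuous; apply/derivable1_diffP; case: (hh' (x 0 i)).
split=> [x|]; first by case: (is_derive_coord j (hh' (x 0 i))).
rewrite (_ : 'D_(delta_mx 0 j) _ = fun x : 'rV[R]_d => (i == j)%:R * h' (x 0 i)).
  by apply: CkM => //; exact: Ck_cst.
by apply/funext => x; case: (is_derive_coord j (hh' (x 0 i))).
Qed.

(** A class closed under derivation consists of smooth functions. The induction on k has to range
    over the whole class [P], since each derivative is another member of it. *)
Lemma Ck_coord k (P : (R -> R) -> Prop) i :
  (forall h, P h -> exists2 h', P h' & forall x : R, is_derive x (1 : R) h (h' x)) ->
  forall h, P h -> Ck k (fun x : 'rV[R]_d => h (x 0 i)).
Proof.
move=> HP; elim: k => [|k IHk] h Ph; last first.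
  by have [h' Ph' hh'] := HP _ Ph; apply: Ck_coordS hh' _; exact: IHk.
have [h' Ph' hh'] := HP _ Ph; split => // x.
apply: (@continuous_comp _ _ _ (fun x : 'rV[R]_d => x 0 i) h).
  exact: coord_continuous.
by apply: differentiable_continuous; apply/derivable1_diffP; case: (hh' (x 0 i)).
Qed.

Lemma Ck_flat k (p : {poly R}) (s t : R) i :
  Ck k (fun x : 'rV[R]_d => flat p (s * x 0 i + t)).
Proof.
pose P (h : R -> R) := exists p, h = fun x => flat p (s * x + t).
apply: (@Ck_coord k P i _ (fun x => flat p (s * x + t))); last by exists p.
move=> _ [q ->]; exists (fun x => flat (s *: ('X^2 * (q - q^`()))) (s * x + t)).
  by eexists.
move=> x; rewrite flatZ mulrC.
have da : is_derive x (1 : R) (fun x : R => s * x + t) s.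
  by apply: is_derive_eq; rewrite addr0 [_ *: _]mulr1.
exact: (@is_derive1_comp R (flat q) (fun x => s * x + t) x _ _ (is_derive_flat _ _) da).
Qed.

End Ck_theory.

(** * Bumps supported in boxes *)

Section bumps.
Context {R : realType}.

Lemma flat1_ge0 (x : R) : 0 <= flat 1 x.
Proof. by rewrite /flat hornerC mul1r; case: ifPn => // _; exact: expR_ge0. Qed.

Lemma flat1_le1 (x : R) : flat 1 x <= 1.
Proof.
rewrite /flat hornerC mul1r; case: ifPn => // x0.
by rewrite -expR0 ler_expR oppr_le0 invr_ge0 ltW.
Qed.

Lemma flat1_gt0 (x : R) : (0 < flat 1 x) = (0 < x).
Proof.
by rewrite /flat hornerC mul1r; case: ifPn => [|_]; rewrite ?expR_gt0 ?ltxx.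
Qed.

Lemma flat1_eq0 (x : R) : x <= 0 -> flat 1 x = 0.
Proof. by rewrite /flat; case: ltP. Qed.

Lemma cvg_flat1_natmul (x : R) : 0 < x -> flat 1 (n%:R * x) @[n --> \oo] --> (1 : R).
Proof.
move=> x0.
have h : expR (- (x^-1 * n%:R^-1)) @[n --> \oo] --> (1 : R).
  have h : - (x^-1 * n%:R^-1) @[n --> \oo] --> (0 : R).
    rewrite -[X in _ --> X]oppr0 -(mulr0 x^-1).
    apply: cvgN; apply: cvgM; first exact: cvg_cst.
    apply/gtr0_cvgV0; last exact: cvgr_idn.
    by near=> n; rewrite ltr0n; near: n; exact: nbhs_infty_gt.
  rewrite -[X in _ --> X](@expR0 R).
  by apply: continuous_cvg; [exact: continuous_expR|exact: h].
apply: cvg_trans h; apply: near_eq_cvg; near=> n.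
have n0 : 0 < n%:R :> R by rewrite ltr0n; near: n; exact: nbhs_infty_gt.
by rewrite /flat mulr_gt0// hornerC mul1r invfM mulrC.
Unshelve. all: by end_near. Qed.

Context {d : nat}.
Implicit Types (a b x : 'rV[R]_d) (n k : nat).

Lemma compact_cbox a b : compact (cbox a b).
Proof.
have := @rV_compact R d (fun i => `[a 0 i, b 0 i]%classic).
rewrite (_ : [set v | _] = cbox a b); first by apply=> i; exact: segment_compact.
by apply/seteqP; split => x h i; have := h i; rewrite /= in_itv.
Qed.

Lemma test_function_cbox (Omega : set 'rV[R]_d) a b f :
  (forall k, Ck k f) -> (forall x, ~ cbox a b x -> f x = 0) ->
  cbox a b `<=` Omega -> test_function Omega f.
Proof.
move=> Cf f0 abO.
have cl : closure [set x | f x != 0] `<=` cbox a b.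
  have -> : cbox a b = closure (cbox a b).
    by apply/closure_id; apply: compact_closed; [exact: norm_hausdorff|exact: compact_cbox].
  apply: closureS => x /= fx0; apply: contrapT => /f0 fx.
  by rewrite fx eqxx in fx0.
split=> //; last exact: subset_trans abO.
by apply: subclosed_compact cl; [exact: closed_closure|exact: compact_cbox].
Qed.

(* The profile exp(-1/(n t)) tends to 1 for t > 0, so these bumps tend to the
   indicator function of the box as n grows. *)
Definition box_bump a b n x : R :=
  \prod_i (flat 1 (n%:R * x 0 i + - (n%:R * a 0 i)) *
           flat 1 (- n%:R * x 0 i + n%:R * b 0 i)).

Lemma Ck_bump k a b n : Ck k (box_bump a b n).
Proof. by apply: Ck_prod => i; apply: CkM; exact: Ck_flat. Qed.

Lemma bump_ge0 a b n x : 0 <= box_bump a b n x.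
Proof. by apply: prodr_ge0 => i _; rewrite mulr_ge0// flat1_ge0. Qed.

Lemma bump_le1 a b n x : box_bump a b n x <= 1.
Proof.
rewrite /box_bump prodr_ile1// => i _.
by rewrite mulr_ge0 ?flat1_ge0//= mulr_ile1 ?flat1_ge0 ?flat1_le1.
Qed.

Lemma bump_gt0 a b n x : (0 < n)%N -> box a b x -> 0 < box_bump a b n x.
Proof.
move=> n0 xab; apply: prodr_gt0 => i _; have /andP[ax xb] := xab i.
have n0' : 0 < n%:R :> R by rewrite ltr0n.
rewrite mulr_gt0// flat1_gt0; first by rewrite -mulrBr mulr_gt0// subr_gt0.
by rewrite mulNr addrC -mulrBr mulr_gt0// subr_gt0.
Qed.

Lemma bump_eq0 a b n x : ~ box a b x -> box_bump a b n x = 0.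
Proof.
move=> /existsNP[i /negP]; rewrite negb_and -!leNgt => h.
apply/eqP/prodf_eq0; exists i => //; rewrite mulf_eq0.
case/orP: h => h; apply/orP; [left|right]; apply/eqP/flat1_eq0.
  by rewrite -mulrBr mulr_ge0_le0// subr_le0.
by rewrite mulNr addrC -mulrBr mulr_ge0_le0// subr_le0.
Qed.

Lemma cvg_bump a b x : box_bump a b n x @[n --> \oo] --> (\1_(box a b) x : R).
Proof.
rewrite indicE; have [xab|xab] := pselect (box a b x); last first.
  rewrite memNset//.
  by under eq_fun do rewrite bump_eq0//; exact: cvg_cst.
rewrite mem_set//= /box_bump.
suff : forall s, \prod_(i <- s) (flat 1 (n%:R * x 0 i + - (n%:R * a 0 i)) *
    flat 1 (- n%:R * x 0 i + n%:R * b 0 i)) @[n --> \oo] --> (1 : R) by exact.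
elim=> [|i s IHs]; first by under eq_fun do rewrite big_nil; exact: cvg_cst.
under eq_fun do rewrite big_cons.
have /andP[ax xb] := xab i.
under eq_fun do rewrite mulNr [- _ + _]addrC -!mulrBr.
rewrite (_ : nbhs (1 : R) = nbhs (1 * 1 * 1 : R)); last by rewrite !mulr1.
by apply: cvgM; [apply: cvgM; apply: cvg_flat1_natmul; rewrite subr_gt0|exact: IHs].
Qed.

Lemma test_function_bump (Omega : set 'rV[R]_d) a b n :
  cbox a b `<=` Omega -> test_function Omega (box_bump a b n).
Proof.
apply: test_function_cbox => [k|x xab]; first exact: Ck_bump.
by apply: bump_eq0 => /box_cbox.
Qed.

End bumps.

(** * Integrals of derivatives of compactly supported functions *)

Section integral_supported.
Context {R : realType}.

Lemma integralT_restrict (dp : measure_display) (T : measurableType dp)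
    (mu : set T -> \bar R) (D : set T) (f : T -> \bar R) :
  (forall x, ~ D x -> f x = 0%E) -> (\int[mu]_x f x = \int[mu]_(x in D) f x)%E.
Proof.
move=> f0; rewrite /integral (_ : f \_ setT = f \_ D)//.
rewrite patch_setT; apply/funext => x; rewrite patchE; case: ifPn => // /negP xD.
by apply: f0 => Dx; apply: xD; rewrite inE.
Qed.

Lemma measurable_cbox n (a b : 'rV[R]_n) : measurable (cbox a b).
Proof.
rewrite -[cbox a b]setCK; apply: measurableC; apply: open_rV_measurable.
apply: closed_openC; apply: compact_closed; first exact: norm_hausdorff.
exact: compact_cbox.
Qed.

Lemma lebesgue_rV_cbox_lty n (a b : 'rV[R]_n) : (lebesgue_rV n (cbox a b) < +oo)%E.
Proof.
(* The maximum keeps the corners ordered even when the closed box is empty, as the volume formula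
   requires. *)
pose b' := \row_i (Num.max (a 0 i) (b 0 i) + 1).
have aM i : a 0 i <= Num.max (a 0 i) (b 0 i) by rewrite le_max lexx.
have bM i : b 0 i <= Num.max (a 0 i) (b 0 i) by rewrite le_max lexx orbT.
have ab i : (a - const_mx 1) 0 i <= b' 0 i by rewrite !mxE; have := aM i; lra.
apply: (@le_lt_trans _ _ (lebesgue_rV n (box (a - const_mx 1) b'))); last first.
  by rewrite lebesgue_rV_box// ltry.
apply: le_measure; rewrite ?inE; [exact: measurable_cbox|exact: measurable_box|].
move=> x xab i; have /andP[ax xb] := xab i; rewrite !mxE.
by have bMi := bM i; apply/andP; split; lra.
Qed.

Lemma compact_bounded_fun n (K : set 'rV[R]_n) (f : 'rV[R]_n -> R) :
  compact K -> {within K, continuous f} -> exists M, forall x, K x -> `|f x| <= M.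
Proof.
move=> cK cf; have /compact_bounded[M [_ mrt]] := continuous_compact cf cK.
exists (M + 1) => x Kx; apply: mrt; last by exists x.
by rewrite ltrDl.
Qed.

Lemma integrable_supported n (a b : 'rV[R]_n) (f : 'rV[R]_n -> R) :
  continuous f -> (forall x, ~ cbox a b x -> f x = 0) ->
  (lebesgue_rV n).-integrable setT (EFin \o f).
Proof.
move=> cf f0.
have -> : EFin \o f = (EFin \o f) \_ (cbox a b).
  apply/funext => x; rewrite patchE; case: ifPn => // /negP xD.
  by rewrite /= f0// => Dx; apply: xD; rewrite inE.
apply/(integrable_mkcond _ (@measurable_cbox n a b)).
apply: measurable_bounded_integrable.
- exact: measurable_cbox.
- exact: lebesgue_rV_cbox_lty.
- by apply: measurable_funTS; exact: continuous_rV_measurable.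
- have [M HM] := compact_bounded_fun (@compact_cbox R n a b) (continuous_subspaceT cf).
  exists M; split; rewrite ?num_real // => t Mt x Kx.
  by apply: le_trans (HM _ Kx) _; exact: ltW.
Qed.

Lemma integral_derive1_supported (h h' : R -> R) (a b : R) :
  (forall x : R, is_derive x (1 : R) h (h' x)) -> continuous h' ->
  (forall x, ~ (a <= x <= b) -> h x = 0) ->
  (\int[lebesgue_measure]_x (h' x)%:E = 0)%E.
Proof.
move=> dh ch h0.
(* Enlarging the interval strictly makes [h] vanish at both ends; the maximum keeps it nondegenerate
   when b < a. *)
pose b' := Num.max a b + 1; pose a' := a - 1.
have aM : a <= Num.max a b by rewrite le_max lexx.
have bM : b <= Num.max a b by rewrite le_max lexx orbT.
have h'0 x : ~ (a' <= x <= b') -> h' x = 0.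
  move=> xab; have [_ <-] := dh x.
  rewrite (@near_eq_derive R R R h (cst 0) x 1) ?derive_cst//.
  have [xa|ax] := ltP x a.
    near=> y; apply: h0; apply/negP; rewrite negb_and -ltNge; apply/orP; left.
    by near: y; exact: lt_nbhsl.
  have bx : b < x by move: xab => /negP; rewrite negb_and -!ltNge /a' /b' => /orP[]; lra.
  near=> y; apply: h0; apply/negP; rewrite negb_and -!ltNge; apply/orP; right.
  by near: y; exact: lt_nbhsr.
transitivity (\int[lebesgue_measure]_(x in `[a', b']) (h' x)%:E)%E.
  by apply: integralT_restrict => x /=; rewrite in_itv/= => xab; rewrite h'0.
have hc : continuous h.
  by move=> x; apply: differentiable_continuous; apply/derivable1_diffP; case: (dh x).
rewrite (@continuous_FTC2 _ h' h a' b').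
- by rewrite !h0 ?subee//; apply/negP; rewrite negb_and -!ltNge; apply/orP;
    rewrite /a' /b'; lra.
- rewrite /a' /b'; lra.
- exact: continuous_subspaceT.
- split; first by move=> x _; case: (dh x).
  + by apply: cvg_at_right_filter; exact: hc.
  + by apply: cvg_at_left_filter; exact: hc.
- by move=> x _; rewrite derive1E; case: (dh x).
Unshelve. all: by end_near. Qed.

Lemma continuous_rV_cons2 n (t : R) : continuous (fun y : 'rV[R]_n => rV_cons (t, y)).
Proof.
move=> y A /nbhs_ballP[e e0 eA]; apply/nbhs_ballP; exists e => //= z [_ yz].
apply: eA; split=> // i j; rewrite ord1; case: (unliftP ord0 j) => [k|] ->.
  by rewrite !rV_consES; exact: yz.
by rewrite !rV_consE0; exact: ballxx.
Qed.

Lemma continuous_rV_cons1 n (y : 'rV[R]_n) : continuous (fun t : R => rV_cons (t, y)).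
Proof.
move=> t A /nbhs_ballP[e e0 eA]; apply/nbhs_ballP; exists e => //= z tz.
apply: eA; split=> // i j; rewrite ord1; case: (unliftP ord0 j) => [k|] ->.
  by rewrite !rV_consES; exact: ballxx.
by rewrite !rV_consE0.
Qed.

Lemma rV_cons_delta0 n (h t : R) (y : 'rV[R]_n) :
  rV_cons (h + t, y) = h *: delta_mx 0 ord0 + rV_cons (t, y).
Proof.
apply/rowP => j; rewrite [RHS]mxE [X in _ = X + _]mxE [delta_mx _ _ _ _]mxE eqxx/=.
case: (unliftP ord0 j) => [k|] ->.
  by rewrite !rV_consES/= mulr0 add0r.
by rewrite !rV_consE0 eqxx mulr1.
Qed.

Lemma rV_cons_deltaS n (h t : R) (y : 'rV[R]_n) k :
  rV_cons (t, h *: delta_mx 0 k + y) = h *: delta_mx 0 (lift ord0 k) + rV_cons (t, y).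
Proof.
apply/rowP => j; rewrite [RHS]mxE [X in _ = X + _]mxE [delta_mx _ _ _ _]mxE eqxx/=.
case: (unliftP ord0 j) => [l|] ->.
  by rewrite !rV_consES/= !mxE eqxx/= (inj_eq (@lift_inj _ ord0)).
by rewrite !rV_consE0 mulr0 add0r.
Qed.

Lemma integral_rV_cons n (f : 'rV[R]_n.+1 -> \bar R) :
  (lebesgue_rV n.+1).-integrable setT f ->
  (lebesgue_measure \x lebesgue_rV n)%E.-integrable setT (f \o @rV_cons R n) /\
  (\int[lebesgue_rV n.+1]_x f x =
   \int[(lebesgue_measure \x lebesgue_rV n)%E]_p f (rV_cons p))%E.
Proof.
move=> fi; have mf := measurable_int _ fi.
have mcons := @measurable_rV_cons R n.
have ic : (lebesgue_measure \x lebesgue_rV n)%E.-integrable setT (f \o @rV_cons R n).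
  apply/integrableP; split; first exact: measurableT_comp.
  have [_] := integrableP _ _ _ fi; apply: le_lt_trans.
  rewrite [leRHS](@ge0_integral_pushforward _ _ _ _ _ _ mcons
    (lebesgue_measure \x lebesgue_rV n)%E)//.
  by apply: measurableT_comp.
by split => //; rewrite [LHS](@integral_pushforward _ _ _ _ _ _ mcons).
Qed.

(** Fubini reduces this to slices. If [j] is the head coordinate, that coordinate is integrated
    innermost and the one-dimensional case applies; otherwise the head is frozen and the induction
    hypothesis applies to the remaining coordinates. *)
Lemma integral_derive_supported n (j : 'I_n) (a b : 'rV[R]_n) (f : 'rV[R]_n -> R) :
  continuous f -> (forall x, derivable f x (delta_mx 0 j)) ->
  continuous ('D_(delta_mx 0 j) f) ->
  (forall x, ~ cbox a b x -> f x = 0) ->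
  (\int[lebesgue_rV n]_x ('D_(delta_mx 0 j) f x)%:E = 0)%E.
Proof.
elim: n j a b f => [|n IHn] j a b f cf df cDf f0; first by have := ltn_ord j.
have Df0 x : ~ cbox a b x -> 'D_(delta_mx 0 j) f x = 0.
  move=> xab; rewrite (@near_eq_derive _ _ _ f (cst 0)) ?derive_cst//.
  have : nbhs x (~` cbox a b).
    apply: open_nbhs_nbhs; split => //; apply: closed_openC.
    by apply: compact_closed; [exact: norm_hausdorff|exact: compact_cbox].
  by apply: filterS => y; exact: f0.
have [ic ->] := integral_rV_cons (integrable_supported cDf Df0).
pose t (x : 'rV[R]_n.+1) : 'rV[R]_n := \row_j x 0 (lift ord0 j).
have notin u y : ~ (a 0 ord0 <= u <= b 0 ord0) \/ ~ cbox (t a) (t b) y ->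
    ~ cbox a b (rV_cons (u, y)).
  move=> h ab; case: h; apply; first by have := ab ord0; rewrite rV_consE0.
  by move=> i; have := ab (lift ord0 i); rewrite rV_consES !mxE.
have [k jE|jE] := unliftP ord0 j.
- rewrite -(integral12_prod_meas1 ic) /fubini_F.
  rewrite -[RHS](integral0 lebesgue_measure setT); apply: eq_integral => u _ /=.
  have dE y : (fun h : R => h^-1 *: (((fun y => f (rV_cons (u, y))) \o shift y)
      (h *: delta_mx 0 k) - f (rV_cons (u, y)))) =
    (fun h : R => h^-1 *: ((f \o shift (rV_cons (u, y)))
      (h *: delta_mx 0 j) - f (rV_cons (u, y)))).
    by apply/funext => h /=; rewrite rV_cons_deltaS jE.
  have DE y : 'D_(delta_mx 0 k) (fun y => f (rV_cons (u, y))) y =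
      'D_(delta_mx 0 j) f (rV_cons (u, y)).
    by rewrite /derive dE.
  under eq_integral do rewrite -DE.
  apply: (IHn k (t a) (t b)).
  + move=> y; apply: (@continuous_comp _ _ _ (fun y => rV_cons (u, y)) f).
      exact: continuous_rV_cons2.
    exact: cf.
  + by move=> y; rewrite /derivable dE; exact: df.
  + rewrite (_ : 'D__ _ = fun y => 'D_(delta_mx 0 j) f (rV_cons (u, y))); last exact/funext.
    move=> y.
    apply: (@continuous_comp _ _ _ (fun y => rV_cons (u, y)) ('D_(delta_mx 0 j) f)).
      exact: continuous_rV_cons2.
    exact: cDf.
  + by move=> y yab; apply: f0; apply: notin; right.
- rewrite -(integral21_prod_meas1 ic) /fubini_G.
  rewrite -[RHS](integral0 (lebesgue_rV n) setT); apply: eq_integral => y _ /=.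
  apply: (@integral_derive1_supported (fun u => f (rV_cons (u, y)))
    (fun u => 'D_(delta_mx 0 j) f (rV_cons (u, y))) (a 0 ord0) (b 0 ord0)).
  + move=> u.
    have dE : (fun h : R => h^-1 *: (((fun u => f (rV_cons (u, y))) \o shift u)
        (h *: (1 : R)) - f (rV_cons (u, y)))) =
      (fun h : R => h^-1 *: ((f \o shift (rV_cons (u, y)))
        (h *: delta_mx 0 j) - f (rV_cons (u, y)))).
      by apply/funext => h /=; rewrite [_ *: 1]mulr1 rV_cons_delta0 jE.
    by split; [rewrite /derivable dE; exact: df|rewrite /derive dE].
  + move=> u.
    apply: (@continuous_comp _ _ _ (fun u => rV_cons (u, y)) ('D_(delta_mx 0 j) f)).
      exact: continuous_rV_cons1.
    exact: cDf.
  + by move=> u uab; apply: f0; apply: notin; left.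
Qed.

End integral_supported.

(** * Square-integrable functions and the fundamental lemma *)

Section L2_domain.
Context {R : realType} {d : nat} {Omega : set 'rV[R]_d}.
Hypotheses (oO : open Omega) (bO : bounded_set Omega).
Local Notation mu := (lebesgue_rV d).
Implicit Types u v : 'rV[R]_d -> R.

Let mO : measurable Omega := open_rV_measurable oO.

Lemma bounded_sub_cbox : exists a b : 'rV[R]_d, Omega `<=` cbox a b.
Proof.
case: bO => M [_ /(_ (M + 1))]; rewrite ltrDl ltr01 => /(_ isT) h.
exists (const_mx (- (M + 1))), (const_mx (M + 1)) => x /h Mx i; rewrite !mxE -ler_norml.
apply: le_trans Mx; rewrite [leRHS]mx_normrE.
exact: (le_bigmax _ (fun i : 'I_1 * 'I_d => `|x i.1 i.2|) (0, i)).
Qed.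

Lemma lebesgue_rV_domain_lty : (mu Omega < +oo)%E.
Proof.
have [a [b Oab]] := bounded_sub_cbox.
apply: (@le_lt_trans _ _ (mu (cbox a b))); last exact: lebesgue_rV_cbox_lty.
by apply: le_measure => //; rewrite inE//; exact: measurable_cbox.
Qed.

Lemma integrable_cst_domain (c : R) : mu.-integrable Omega (EFin \o (fun=> c)).
Proof.
apply: measurable_bounded_integrable => //; first exact: lebesgue_rV_domain_lty.
by exists `|c|; split; rewrite ?num_real // => M Mc x _; exact: ltW.
Qed.

Lemma L2_integrable_mul u v : L2 Omega u -> L2 Omega v ->
  mu.-integrable Omega (EFin \o (fun x => u x * v x)).
Proof.
move=> [mu_ iu] [mv iv].
apply: (le_integrable mO _ _ (integrableD mO iu iv)).
  by apply/measurable_EFinP; exact: measurable_funM.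
move=> x Ox /=; rewrite lee_fin [leRHS]ger0_norm ?addr_ge0 ?sqr_ge0//.
rewrite normrM -(real_normK (num_real (u x))) -(real_normK (num_real (v x))).
by have := sqr_ge0 (`|u x| - `|v x|); have := normr_ge0 (u x); have := normr_ge0 (v x); nra.
Qed.

Lemma L2_cst c : L2 Omega (fun=> c).
Proof. by split; [exact: measurable_cst|exact: (integrable_cst_domain (c ^+ 2))]. Qed.

Lemma L2_integrable u : L2 Omega u -> mu.-integrable Omega (EFin \o u).
Proof.
move=> /(L2_integrable_mul (L2_cst 1)); congr (integrable _ _ _).
by apply/funext => x /=; rewrite mul1r.
Qed.

Lemma L2_lin a u v : L2 Omega u -> L2 Omega v -> L2 Omega (fun x => a * u x + v x).
Proof.
move=> hu hv; have [[mu_ iu] [mv iv]] := (hu, hv).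
have mm : measurable_fun Omega (fun x => a * u x + v x).
  by apply: measurable_funD => //; apply: measurable_funM.
split => //.
have := integrableD mO (integrableD mO (integrableZl mO (a ^+ 2) iu) iv)
  (integrableZl mO (2 * a) (L2_integrable_mul hu hv)).
congr (integrable _ _ _); apply/funext => x /=.
by rewrite -!EFinM -!EFinD; congr EFin; ring.
Qed.

Lemma compact_closure_domain : compact (closure Omega).
Proof.
have [a [b Oab]] := bounded_sub_cbox.
have cc := @compact_cbox R d a b.
have cl : closure Omega `<=` cbox a b.
  rewrite closureE => x; apply; split => //.
  by apply: compact_closed => //; exact: norm_hausdorff.
by apply: subclosed_compact cl; [exact: closed_closure|exact: cc].
Qed.

Lemma L2_continuous u : {within closure Omega, continuous u} -> L2 Omega u.
Proof.
move=> cu; have mu_ : measurable_fun Omega u.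
  apply: within_continuous_rV_measurable => //.
  exact: continuous_subspaceW (@subset_closure _ Omega) cu.
have [M HM] := compact_bounded_fun compact_closure_domain cu.
split => //; apply: (@measurable_bounded_integrable _ _ _ _ (fun x => u x ^+ 2)) => //.
- exact: lebesgue_rV_domain_lty.
- exact: measurable_funX.
- exists (M ^+ 2); split; rewrite ?num_real// => K MK x Ox.
  apply: le_trans (ltW MK); rewrite normrX; have Mx := HM x (subset_closure Ox).
  by rewrite lerXn2r ?nnegrE// (le_trans _ Mx).
Qed.

Lemma L2_continuousT u : continuous u -> L2 Omega u.
Proof. by move=> cu; apply: L2_continuous; exact: continuous_subspaceT. Qed.

Lemma Rintegral_eq0 u : mu.-integrable Omega (EFin \o u) ->
  \int[mu]_(x in Omega) u x = 0 -> (\int[mu]_(x in Omega) (u x)%:E = 0)%E.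
Proof.
move=> iu u0; rewrite -[LHS]fineK ?integrable_fin_num//.
by move: u0; rewrite /Rintegral => ->.
Qed.

Lemma test_function_continuous f : test_function Omega f -> continuous f.
Proof. by move=> [/(_ 0%N)/Ck_continuous]. Qed.

(** The bumps on the box converge pointwise to its indicator and stay below 1, so dominated
    convergence with bound |g| passes to the limit in the identities for test functions. *)
Lemma fundamental_lemma_box (g : 'rV[R]_d -> R) (a b : 'rV[R]_d) : L2 Omega g ->
  (forall f, test_function Omega f -> \int[mu]_(x in Omega) (g x * f x) = 0) ->
  cbox a b `<=` Omega -> (\int[mu]_(x in box a b) (g x)%:E = 0)%E.
Proof.
move=> Lg g0 abO.
have mg : measurable_fun Omega (EFin \o g) by apply/measurable_EFinP; case: Lg.
have gf0 n : (\int[mu]_(x in Omega) (g x * box_bump a b n x)%:E = 0)%E.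
  apply: Rintegral_eq0; last by apply: g0; exact: test_function_bump.
  apply: L2_integrable_mul => //; apply: L2_continuousT.
  by apply: test_function_continuous; exact: test_function_bump.
have [] := @dominated_convergence _ _ _ mu Omega mO
  (fun n x => (g x * box_bump a b n x)%:E) ((EFin \o g) \_ (box a b))
  (abse \o (EFin \o g)).
- move=> n; apply/measurable_EFinP; apply: measurable_funM; first by case: Lg.
  apply: measurable_funTS; apply: continuous_rV_measurable.
  exact: test_function_continuous (test_function_bump n abO).
- apply/(measurable_restrict _ (@measurable_box _ _ a b) mO).
  by apply: measurable_funS mg => //; exact: subIsetl.
- apply: aeW => x Ox.
  rewrite (_ : ((_ \_ _) x) = (g x * \1_(box a b) x)%:E); last first.
    by rewrite patchE indicE; case: ifPn => _; rewrite ?mulr1// mulr0.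
  apply: cvg_EFin; first exact: nearW.
  by apply: cvgM; [exact: cvg_cst|exact: cvg_bump].
- by apply: integrable_abse; exact: L2_integrable.
- apply: aeW => x n Ox /=; rewrite lee_fin normrM ler_piMr// ger0_norm ?bump_ge0 ?bump_le1//.
move=> _ _; under eq_fun do rewrite gf0.
move=> /(@cvg_unique _ (@ereal_hausdorff R) _ _ _ _ (cvg_cst 0%E)).
rewrite -integral_mkcondr setIidr//.
exact: subset_trans (@box_cbox _ _ a b) abO.
Qed.

(** Dynkin induction extends the vanishing of the integral of [g] from boxes to every measurable
    subset of [B], which forces [g] to be zero almost everywhere there. *)
Lemma fundamental_lemma_ae_box (g : 'rV[R]_d -> R) (a b : 'rV[R]_d) : L2 Omega g ->
  (forall f, test_function Omega f -> \int[mu]_(x in Omega) (g x * f x) = 0) ->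
  cbox a b `<=` Omega -> {ae mu, forall x, box a b x -> g x = 0}.
Proof.
move=> Lg g0 abO; set B := box a b.
have mB : measurable B by exact: measurable_box.
have BO : B `<=` Omega := subset_trans (@box_cbox _ _ a b) abO.
have iB : mu.-integrable B (EFin \o g) by apply: integrableS (L2_integrable Lg).
have gB0 : (\int[mu]_(x in B) (g x)%:E = 0)%E by exact: fundamental_lemma_box.
(* Intersecting with [B] makes the class contain the full space and keeps [g] integrable on
   complements and countable unions. *)
pose P (S : set 'rV[R]_d) := (\int[mu]_(x in S `&` B) (g x)%:E = 0)%E.
have PS : forall S, measurable S -> P S.
  rewrite [X in forall S, X S -> _]measurable_rV_box; apply: dynkin_induction.
  - exact: measurable_rV_box.
  - exact: setI_closed_box.
  - by rewrite /P setTI.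
  - move=> _ [a' [b' ->]]; rewrite /P /B boxI; apply: fundamental_lemma_box => //.
    apply: subset_trans abO => x h i; have := h i; rewrite !mxE ge_max le_min.
    by move=> /andP[/andP[_ ->] /andP[_ ->]].
  - move=> S mS PS; rewrite /P.
    have : (\int[mu]_(x in (S `&` B) `|` (~` S `&` B)) (g x)%:E = 0)%E.
      by rewrite -setIUl setUv setTI.
    rewrite integral_setU //; first by rewrite PS add0e.
    + exact: measurableI.
    + by apply: measurableI => //; exact: measurableC.
    + by rewrite -setIUl setUv setTI; exact: measurable_int iB.
    + by apply/disj_setPS => x [[Sx _] [nSx _]].
  - move=> F mF tF PF; rewrite /P setI_bigcupl integral_bigcup.
    + by apply: eseries0 => n _ _; exact: PF.
    + exact: trivIset_setIr.
    + by move=> k; exact: measurableI.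
    + apply: integrableS iB => //.
        by apply: bigcup_measurable => k _; exact: measurableI.
      by move=> x [k _ []].
have := @integral_ae_eq _ _ _ mu B mB (cst 0%E) (EFin \o g) iB (measurable_cst _) _.
have h : forall E, E `<=` B -> measurable E ->
    (\int[mu]_(x in E) (g x)%:E = \int[mu]_(x in E) cst 0 x)%E.
  by move=> E EB mE; rewrite integral0; have := PS _ mE; rewrite /P setIidl.
move=> /(_ h); apply: filterS => x /= hx Bx.
by have := hx Bx => -[].
Qed.

Lemma fundamental_lemma (g : 'rV[R]_d -> R) : L2 Omega g ->
  (forall f, test_function Omega f -> \int[mu]_(x in Omega) (g x * f x) = 0) ->
  {ae mu, forall x, Omega x -> g x = 0}.
Proof.
move=> Lg g0; have [D [p [q [DO OE]]]] := open_bigcup_box oO.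
have : {ae mu, forall x, forall k, D k -> box (p k) (q k) x -> g x = 0}.
  apply: ae_foralln => k.
  have [Dk|nDk] := pselect (D k); last by apply: aeW => x /nDk.
  have := fundamental_lemma_ae_box Lg g0 (DO k Dk).
  by apply: filterS => x hx _; exact: hx.
by apply: filterS => x hx; rewrite OE => -[k Dk]; exact: hx.
Qed.

End L2_domain.

(** * Weak gradients and the Dirichlet form *)

Section weak_gradient.
Context {R : realType} {d : nat} {Omega : set 'rV[R]_d}.
Hypotheses (oO : open Omega) (bO : bounded_set Omega).
Local Notation mu := (lebesgue_rV d).
Implicit Types (u v w : 'rV[R]_d -> R) (g h : 'rV[R]_d -> 'rV[R]_d).

Let mO : measurable Omega := open_rV_measurable oO.

(** The vanishing integral is what gives constants the weak gradient 0; later it also allows a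
    constant to be subtracted from a function tested against derivatives. *)
Lemma test_function_derive f (j : 'I_d) : test_function Omega f ->
  continuous ('D_(delta_mx 0 j) f) /\
  \int[mu]_(x in Omega) 'D_(delta_mx 0 j) f x = 0.
Proof.
move=> [Cf _ fO]; have [cf /(_ j)[df [cDf _]]] := Cf 1%N.
have f0 x : ~ Omega x -> f x = 0.
  move=> nOx; apply: contrapT => /eqP fx0; apply: nOx; apply: fO.
  exact: subset_closure.
have Df0 x : ~ Omega x -> 'D_(delta_mx 0 j) f x = 0.
  move=> nOx; rewrite (@near_eq_derive _ _ _ f (cst 0)) ?derive_cst//.
  have : nbhs x (~` closure [set x | f x != 0]).
    apply: open_nbhs_nbhs; split; last by move=> /fO.
    by apply: closed_openC; exact: closed_closure.
  apply: filterS => y nfy; apply: contrapT => /eqP fy0; apply: nfy.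
  exact: subset_closure.
have [a [b Oab]] := bounded_sub_cbox bO.
split => //; rewrite /Rintegral -integralT_restrict; last by move=> x /Df0 ->.
by rewrite (@integral_derive_supported _ _ j a b)// => x xab; apply: f0 => /Oab.
Qed.

Lemma is_weak_grad_cst (c : R) : is_weak_grad Omega (fun=> c) (fun=> 0).
Proof.
split=> [j|f tf j].
  rewrite (_ : (fun x => _) = fun=> 0); first exact: L2_cst.
  by apply/funext => x; rewrite mxE.
have [cDf f0] := test_function_derive j tf.
rewrite RintegralZl//; last by apply: L2_integrable => //; exact: L2_continuousT.
rewrite f0 mulr0 (@eq_Rintegral _ _ _ _ _ (fun=> 0)) ?Rintegral_cst ?mul0r ?oppr0//.
by move=> x _; rewrite mxE mul0r.
Qed.

Lemma is_weak_grad_lin a u v gu gv : L2 Omega u -> L2 Omega v ->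
  is_weak_grad Omega u gu -> is_weak_grad Omega v gv ->
  is_weak_grad Omega (fun x => a * u x + v x) (fun x => a *: gu x + gv x).
Proof.
move=> Lu Lv [Lgu gu_] [Lgv gv_]; split=> [j|f tf j].
  rewrite (_ : (fun x => _) = fun x => a * gu x 0 j + gv x 0 j); first exact: L2_lin.
  by apply/funext => x; rewrite !mxE.
have [cDf _] := test_function_derive j tf.
have LDf := L2_continuousT oO bO cDf.
have Lf := L2_continuousT oO bO (test_function_continuous tf).
transitivity (a * \int[mu]_(x in Omega) (u x * 'D_(delta_mx 0 j) f x) +
    \int[mu]_(x in Omega) (v x * 'D_(delta_mx 0 j) f x)).
  rewrite -RintegralZl//; last exact: L2_integrable_mul.
  rewrite -RintegralD//; last 2 first.
  - exact: (integrableZl mO a (L2_integrable_mul oO Lu LDf)).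
  - exact: L2_integrable_mul.
  by apply: eq_Rintegral => x _; rewrite mulrDl mulrA.
rewrite gu_// gv_// mulrN -opprD; congr (- _).
rewrite -RintegralZl//; last exact: L2_integrable_mul.
rewrite -RintegralD//; last 2 first.
- exact: (integrableZl mO a (L2_integrable_mul oO (Lgu j) Lf)).
- exact: L2_integrable_mul.
by apply: eq_Rintegral => x _; rewrite !mxE mulrDl mulrA.
Qed.

Lemma is_weak_grad_unique u g h : is_weak_grad Omega u g -> is_weak_grad Omega u h ->
  forall j, {ae mu, forall x, Omega x -> g x 0 j = h x 0 j}.
Proof.
move=> [Lg g_] [Lh h_] j.
have Lgh : L2 Omega (fun x => - 1 * h x 0 j + g x 0 j) by exact: L2_lin.
have := fundamental_lemma oO bO Lgh.
have gh0 f : test_function Omega f ->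
    \int[mu]_(x in Omega) ((- 1 * h x 0 j + g x 0 j) * f x) = 0.
  move=> tf; have Lf := L2_continuousT oO bO (test_function_continuous tf).
  have -> : \int[mu]_(x in Omega) ((- 1 * h x 0 j + g x 0 j) * f x) =
    - 1 * \int[mu]_(x in Omega) (h x 0 j * f x) + \int[mu]_(x in Omega) (g x 0 j * f x).
    rewrite -RintegralZl//; last exact: L2_integrable_mul.
    rewrite -RintegralD//; last 2 first.
    - exact: (integrableZl mO (-1) (L2_integrable_mul oO (Lh j) Lf)).
    - exact: L2_integrable_mul.
    by apply: eq_Rintegral => x _; rewrite mulrDl mulrA.
  apply/eqP; rewrite mulN1r addrC subr_eq0 -eqr_opp.
  by rewrite -g_// -h_.
move=> /(_ gh0); apply: filterS => x /[apply]; rewrite mulN1r addrC => /eqP.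
by rewrite subr_eq0 => /eqP.
Qed.

Lemma weak_gradP u : H1 Omega u -> is_weak_grad Omega u (weak_grad Omega u).
Proof. by move=> [_ [g gu]]; exact: (xgetPex _ (ex_intro _ g gu)). Qed.

Lemma Rintegral_sum (I : Type) (s : seq I) (F : I -> 'rV[R]_d -> R) :
  (forall i, mu.-integrable Omega (EFin \o F i)) ->
  mu.-integrable Omega (EFin \o (fun x => \sum_(i <- s) F i x)) /\
  \int[mu]_(x in Omega) (\sum_(i <- s) F i x) =
  \sum_(i <- s) \int[mu]_(x in Omega) F i x.
Proof.
move=> iF; elim: s => [|i s [iS IHs]].
  have E0 : (fun x : 'rV[R]_d => \sum_(i <- [::]) F i x) = fun=> 0.
    by apply/funext => x; rewrite big_nil.
  rewrite E0 big_nil Rintegral_cst// mul0r; split => //; exact: integrable_cst_domain.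
have ES : (fun x : 'rV[R]_d => \sum_(i <- i :: s) F i x) =
    fun x => F i x + \sum_(i <- s) F i x.
  by apply/funext => x; rewrite big_cons.
rewrite ES big_cons RintegralD// IHs; split => //.
exact: (integrableD mO (iF i) iS).
Qed.

Definition L2_field g := forall j, L2 Omega (fun x => g x 0 j).

Lemma L2_inner_sum g h : L2_field g -> L2_field h ->
  L2_inner Omega g h = \sum_j \int[mu]_(x in Omega) (g x 0 j * h x 0 j).
Proof.
move=> Lg Lh; rewrite /L2_inner /dotv.
by have [] := Rintegral_sum (index_enum 'I_d) (fun j => L2_integrable_mul oO (Lg j) (Lh j)).
Qed.

Lemma L2_inner_sym g h : L2_inner Omega g h = L2_inner Omega h g.
Proof.
by apply: eq_Rintegral => x _; apply: eq_bigr => j _; rewrite mulrC.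
Qed.

Lemma L2_inner_linl a g1 g2 h : L2_field g1 -> L2_field g2 -> L2_field h ->
  L2_inner Omega (fun x => a *: g1 x + g2 x) h =
  a * L2_inner Omega g1 h + L2_inner Omega g2 h.
Proof.
move=> L1 L2 Lh; rewrite !L2_inner_sum// => [|j]; last first.
  rewrite (_ : (fun x => _) = fun x => a * g1 x 0 j + g2 x 0 j); first exact: L2_lin.
  by apply/funext => x; rewrite !mxE.
rewrite mulr_sumr -big_split; apply: eq_bigr => j _ /=.
rewrite -RintegralZl//; last exact: L2_integrable_mul.
rewrite -RintegralD//; last 2 first.
- exact: (integrableZl mO a (L2_integrable_mul oO (L1 j) (Lh j))).
- exact: L2_integrable_mul.
by apply: eq_Rintegral => x _; rewrite !mxE mulrDl mulrA.
Qed.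

Lemma L2_inner_ae g g' h : L2_field g -> L2_field g' -> L2_field h ->
  (forall j, {ae mu, forall x, Omega x -> g x 0 j = g' x 0 j}) ->
  L2_inner Omega g h = L2_inner Omega g' h.
Proof.
move=> Lg Lg' Lh gg'; rewrite !L2_inner_sum//; apply: eq_bigr => j _.
rewrite /Rintegral; congr fine; apply: ae_eq_integral => //.
- exact: measurable_int (L2_integrable_mul oO (Lg j) (Lh j)).
- exact: measurable_int (L2_integrable_mul oO (Lg' j) (Lh j)).
- by apply: filterS (gg' j) => x /[apply] ->.
Qed.

Lemma L2_inner_ge0 g : 0 <= L2_inner Omega g g.
Proof.
by apply: Rintegral_ge0 => x _; apply: sumr_ge0 => j _; rewrite -expr2 sqr_ge0.
Qed.

Lemma L2_inner_eq0 g : L2_field g -> L2_inner Omega g g = 0 ->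
  forall j, {ae mu, forall x, Omega x -> g x 0 j = 0}.
Proof.
move=> Lg; rewrite L2_inner_sum// => /eqP; rewrite psumr_eq0; last first.
  by move=> j _; apply: Rintegral_ge0 => x _; rewrite -expr2 sqr_ge0.
move=> /allP gj0 j; have /eqP gj := gj0 j (mem_index_enum j).
have ig := L2_integrable_mul oO (Lg j) (Lg j).
have := Rintegral_eq0 oO ig gj.
have [+ _] := @ae_eq_integral_abs _ _ _ mu Omega mO _ (measurable_int _ ig).
rewrite (_ : (\int[mu]_(x in Omega) `|_|)%E =
    \int[mu]_(x in Omega) (g x 0 j * g x 0 j)%:E)%E.
  move=> /[apply]; apply: filterS => x /= hx Ox; have := hx Ox => -[].
  by move=> /eqP; rewrite mulf_eq0 orbb => /eqP.
by apply: eq_integral => x _ /=; rewrite ger0_norm// -expr2 sqr_ge0.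
Qed.

Definition grad_form u w := L2_inner Omega (weak_grad Omega u) (weak_grad Omega w).

Lemma H1_lin a u v : H1 Omega u -> H1 Omega v -> H1 Omega (fun x => a * u x + v x).
Proof.
move=> [Lu [gu hu]] [Lv [gv hv]]; split; first exact: L2_lin.
by eexists; exact: is_weak_grad_lin hu hv.
Qed.

Lemma grad_form_sym u w : grad_form u w = grad_form w u.
Proof. exact: L2_inner_sym. Qed.

Lemma grad_form_ge0 u : 0 <= grad_form u u.
Proof. exact: L2_inner_ge0. Qed.

Lemma weak_grad_L2 u : H1 Omega u -> L2_field (weak_grad Omega u).
Proof. by move=> /weak_gradP[]. Qed.

Lemma grad_form_linl a u v w : H1 Omega u -> H1 Omega v -> H1 Omega w ->
  grad_form (fun x => a * u x + v x) w = a * grad_form u w + grad_form v w.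
Proof.
move=> hu hv hw; have hl := H1_lin a hu hv.
have hg := is_weak_grad_lin a hu.1 hv.1 (weak_gradP hu) (weak_gradP hv).
rewrite /grad_form -L2_inner_linl; [|exact: weak_grad_L2..].
apply: L2_inner_ae; [exact: weak_grad_L2|exact: hg.1|exact: weak_grad_L2|].
exact: is_weak_grad_unique (weak_gradP hl) hg.
Qed.

Lemma H1_cst c : H1 Omega (fun=> c).
Proof. by split; [exact: L2_cst|eexists; exact: is_weak_grad_cst]. Qed.

Lemma grad_form_cstl c w : H1 Omega w -> grad_form (fun=> c) w = 0.
Proof.
move=> hw; have h0 := is_weak_grad_cst c.
rewrite /grad_form (@L2_inner_ae _ (fun=> 0)); last 4 first.
- exact/weak_grad_L2/H1_cst.
- exact: h0.1.
- exact: weak_grad_L2.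
- exact: is_weak_grad_unique (weak_gradP (H1_cst c)) h0.
rewrite L2_inner_sum//; [|exact: h0.1|exact: weak_grad_L2].
rewrite big1// => j _; rewrite (@eq_Rintegral _ _ _ _ _ (fun=> 0)) ?Rintegral_cst ?mul0r//.
by move=> x _; rewrite mxE mul0r.
Qed.

(** The conclusion is phrased by duality, free of the chosen representative [weak_grad]: this is the
    form from which constancy is derived. *)
Lemma grad_form_eq0 u : H1 Omega u -> grad_form u u = 0 ->
  forall f j, test_function Omega f ->
  \int[mu]_(x in Omega) (u x * 'D_(delta_mx 0 j) f x) = 0.
Proof.
move=> hu u0 f j tf; have [Lg ->//] := weak_gradP hu.
have g0 := L2_inner_eq0 Lg u0 j.
have Lf := L2_continuousT oO bO (test_function_continuous tf).
apply/eqP; rewrite oppr_eq0; apply/eqP; rewrite /Rintegral.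
rewrite (@ae_eq_integral _ _ _ mu Omega (cst 0%E)) ?integral0//.
  exact: measurable_int (L2_integrable_mul oO (Lg j) Lf).
by apply: filterS g0 => x /[apply] ->; rewrite mul0r.
Qed.

End weak_gradient.

(** * Functions with zero weak gradient *)

Section bump_primitive.
Context {R : realType}.

Definition bump1 (r t : R) : R := flat 1 (t + r) * flat 1 (r - t).

Lemma bump1_eq0 (r t : R) : ~ (- r < t < r) -> bump1 r t = 0.
Proof.
move=> /negP; rewrite negb_and -!leNgt /bump1 => /orP[] h.
  by rewrite flat1_eq0 ?mul0r//; lra.
by rewrite [X in _ * X]flat1_eq0 ?mulr0//; lra.
Qed.

Lemma continuous_bump1 (r : R) : continuous (bump1 r).
Proof.
have cf : continuous (flat 1 : R -> R).
  move=> t; apply: differentiable_continuous; apply/derivable1_diffP.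
  by case: (is_derive_flat 1 t).
move=> t; apply: (@continuousM _ _ (fun t => flat 1 (t + r)) (fun t => flat 1 (r - t))).
  apply: (@continuous_comp _ _ _ (fun t => t + r) (flat 1)); last exact: cf.
  exact: (@continuousD _ _ _ id (cst r) t (@cvg_id _ _) (@cst_continuous _ _ _ _)).
apply: (@continuous_comp _ _ _ (fun t => r - t) (flat 1)); last exact: cf.
exact: (@continuousB _ _ _ (cst r) id t (@cst_continuous _ _ _ _) (@cvg_id _ _)).
Qed.

(** [P] integrates the bump from minus infinity, so it ends at the total mass [c] and is not
    compactly supported; the difference of two translates of [P] is. *)
Lemma bump1_primitive (r : R) : 0 < r -> exists P : R -> R, exists c : R,
  [/\ forall t : R, is_derive t (1 : R) P (bump1 r t), forall t, t <= - r -> P t = 0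
    & forall t, r <= t -> P t = c].
Proof.
move=> r0; have cb := @continuous_bump1 r.
have ib : lebesgue_measure.-integrable setT (EFin \o bump1 r).
  rewrite (_ : EFin \o _ = (EFin \o bump1 r) \_ `[- r, r]); last first.
    apply/funext => t; rewrite patchE; case: ifPn => // /negP tr.
    rewrite /= bump1_eq0// => /andP[t1 t2]; apply: tr.
    by rewrite inE/= in_itv/= !ltW.
  have [+ _] := @integrable_mkcond _ (measurableTypeR R) R lebesgue_measure
    `[- r, r]%classic (EFin \o bump1 r) (measurable_itv _).
  apply.
  apply: continuous_compact_integrable; first exact: segment_compact.
  exact: continuous_subspaceT.
exists (fun t => \int[lebesgue_measure]_(s in `]-oo, t]) bump1 r s).
exists (\int[lebesgue_measure]_s bump1 r s); split.
- move=> t; have [] := @continuous_FTC1 R (bump1 r) (BInfty R true) t (t + 1) _ _ _ (cb t).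
  + by rewrite ltrDl.
  + by apply: integrableS ib.
  + by rewrite /= ltNyr.
  + by move=> d1 d2; split; [exact: d1|rewrite -d2 derive1E].
- move=> t tr; rewrite (@eq_Rintegral _ _ _ _ _ (fun=> 0)) ?Rintegral_cst ?mul0r//.
  move=> s; rewrite inE/= in_itv/= => st; apply: bump1_eq0; lra.
- move=> t tr; rewrite /Rintegral; congr fine; apply/esym.
  apply: integralT_restrict => s /= st; rewrite bump1_eq0//.
  by move: st; rewrite in_itv/= => /negP; rewrite -ltNge; lra.
Qed.

End bump_primitive.

Section zero_weak_gradient.
Context {R : realType} {d : nat} {Omega : set 'rV[R]_d}.
Hypotheses (oO : open Omega) (bO : bounded_set Omega).
Local Notation mu := (lebesgue_rV d).
Implicit Types (x y z p q : 'rV[R]_d).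

Let mO : measurable Omega := open_rV_measurable oO.

Let cube x r := box (x - const_mx r) (x + const_mx r).
Let ccube x r := cbox (x - const_mx r) (x + const_mx r).

(** A box bump at index 1, written around its centre so that the factor of one coordinate can be
    replaced by its primitive. *)
Definition cube_bump x r z : R := \prod_i bump1 r (z 0 i - x 0 i).

Lemma cube_bumpE x r : cube_bump x r = box_bump (x - const_mx r) (x + const_mx r) 1.
Proof.
apply/funext => z; apply: eq_bigr => i _; rewrite !mxE /bump1.
by congr (flat 1 _ * flat 1 _); ring.
Qed.

Lemma is_derive_invariant (f : 'rV[R]_d -> R) x v :
  (forall h : R, f (h *: v + x) = f x) -> is_derive x v f 0.
Proof.
move=> fv; have E : (fun h : R => h^-1 *: ((f \o shift x) (h *: v) - f x)) = cst 0.
  by apply/funext => h /=; rewrite fv subrr scaler0.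
split; first by rewrite /derivable E; exact: is_cvg_cst.
by rewrite /derive E; apply: cvg_lim => //; exact: cvg_cst.
Qed.

(* P' = bump1 r, so the derivative along e_j of
   (P(z_j - x_j) - P(z_j - y_j)) prod_(i != j) bump1 r (z_i - x_i)
   is the difference of two bumps centred at x and y. *)
Lemma cube_bump_difference x y (j : 'I_d) (r : R) : 0 < r ->
  (forall i, i != j -> x 0 i = y 0 i) ->
  cbox (\row_i (Num.min (x 0 i) (y 0 i) - r)) (\row_i (Num.max (x 0 i) (y 0 i) + r))
    `<=` Omega ->
  exists2 f, test_function Omega f &
    forall z, 'D_(delta_mx 0 j) f z = cube_bump x r z - cube_bump y r z.
Proof.
move=> r0 xy xyO; have [P [c [dP P0 Pc]]] := bump1_primitive r0.
pose A z := P (z 0 j - x 0 j) + (- 1) * P (z 0 j - y 0 j).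
pose B z := \prod_i (if i == j then 1 else bump1 r (z 0 i - x 0 i)).
have Cbump (s : R) k i : Ck k (fun z : 'rV[R]_d => bump1 r (z 0 i - s)).
  rewrite (_ : (fun z => _) = fun z : 'rV[R]_d =>
      flat 1 (1 * z 0 i + (r - s)) * flat 1 (- 1 * z 0 i + (r + s))).
    by apply: CkM; exact: Ck_flat.
  by apply/funext => z; rewrite /bump1; congr (flat 1 _ * flat 1 _); ring.
have dPs (s t : R) : is_derive t (1 : R) (fun t => P (t - s)) (bump1 r (t - s)).
  have da : is_derive t (1 : R) (fun t : R => t - s) 1.
    by apply: is_derive_eq; exact: subr0.
  have := @is_derive1_comp R P (fun t => t - s) t _ _ (dP _) da.
  by rewrite mulr1.
have CP (s : R) k : Ck k (fun z : 'rV[R]_d => P (z 0 j - s)).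
  by apply: CkS; apply: (@Ck_coordS _ _ _ (fun t => P (t - s))) (dPs s) _; exact: Cbump.
exists (fun z => A z * B z).
  apply: test_function_cbox xyO => [k|z zxy].
    apply: CkM; first by apply: CkD => //; apply: CkM => //; exact: Ck_cst.
    apply: Ck_prod => i; case: (i == j); [exact: Ck_cst|exact: Cbump].
  apply/eqP; rewrite mulf_eq0; apply/orP.
  move/existsNP : zxy => [i]; rewrite !mxE => zi.
  (* Outside the range of coordinate j both primitives are 0 or both equal [c], so [A] vanishes;
     outside the range of another coordinate a bump factor of [B] does. *)
  have [ij|ij] := eqVneq i j; [left|right].
    rewrite /A -ij.
    have m1 : Num.min (x 0 i) (y 0 i) <= x 0 i by rewrite ge_min lexx.
    have m2 : Num.min (x 0 i) (y 0 i) <= y 0 i by rewrite ge_min lexx orbT.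
    have m3 : x 0 i <= Num.max (x 0 i) (y 0 i) by rewrite le_max lexx.
    have m4 : y 0 i <= Num.max (x 0 i) (y 0 i) by rewrite le_max lexx orbT.
    move: zi => /negP; rewrite negb_and -!ltNge => /orP[] h.
      by rewrite !P0 ?mulr0 ?addr0//; lra.
    by rewrite !Pc; [rewrite mulN1r subrr|lra|lra].
  apply/prodf_eq0; exists i => //; rewrite (negbTE ij); apply/eqP/bump1_eq0.
  move: zi; rewrite -xy// minxx maxxx => h /andP[h1 h2].
  by apply: h; apply/andP; split; lra.
move=> z.
have dA : is_derive z (delta_mx 0 j) A (bump1 r (z 0 j - x 0 j) - bump1 r (z 0 j - y 0 j)).
  have d1 := is_derive_coord j (dPs (x 0 j) (z 0 j)).
  have d2 := is_derive_coord j (dPs (y 0 j) (z 0 j)).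
  have := is_deriveD d1 (is_deriveM (is_derive_cst (- 1 : R) z (delta_mx 0 j)) d2).
  by rewrite eqxx !mul1r scaler0 addr0 scaleN1r.
have dB : is_derive z (delta_mx 0 j) B 0.
  apply: is_derive_invariant => h; apply: eq_bigr => i _; case: ifPn => // ij.
  by rewrite !mxE (negbTE ij) andbF mulr0 add0r.
have [_ ->] := is_deriveM dA dB.
have E s : cube_bump s r z =
    bump1 r (z 0 j - s 0 j) * \prod_(i | i != j) bump1 r (z 0 i - s 0 i).
  by rewrite /cube_bump (bigD1 j).
have -> : B z = \prod_(i | i != j) bump1 r (z 0 i - x 0 i).
  by rewrite /B (bigD1 j)//= eqxx mul1r; apply: eq_bigr => i /negbTE ->.
rewrite scaler0 add0r [_ *: _]mulrC mulrBl !E; congr (_ * _ - _ * _).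
by apply: eq_bigr => i ij; rewrite xy.
Qed.

(** If u x > u y, take a level m strictly between and cubes around x and y on which u > m and u < m
    respectively. Then (u - m) times the difference of the two bumps is nonnegative with zero
    integral, hence null almost everywhere, although it is positive on the cube around x, which has
    positive volume. *)
Lemma zero_weak_grad_step (u : 'rV[R]_d -> R) x y (j : 'I_d) p q :
  {within Omega, continuous u} -> L2 Omega u ->
  (forall f, test_function Omega f ->
    \int[mu]_(z in Omega) (u z * 'D_(delta_mx 0 j) f z) = 0) ->
  box p q `<=` Omega -> box p q x -> box p q y ->
  (forall i, i != j -> x 0 i = y 0 i) -> u x <= u y.
Proof.
rewrite continuous_open_subspace// => cu Lu uD pqO xpq ypq xy.
rewrite leNgt; apply/negP => yx; pose m := (u x + u y) / 2.
have ym : u y < m by rewrite /m; lra.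
have mx : m < u x by rewrite /m; lra.
have near_ball (s : 'rV[R]_d) (W : set R) : box p q s -> nbhs (u s) W ->
    exists2 e, 0 < e & ball s e `<=` [set z | W (u z)] `&` box p q.
  move=> spq uW; have : nbhs s ([set z | W (u z)] `&` box p q).
    apply: filterI; last by apply: open_nbhs_nbhs; split => //; exact: open_box.
    by apply: cu => //; rewrite inE; exact: pqO.
  by move=> /nbhs_ballP[e e0 eW]; exists e.
have [r1 r10 xr1] := near_ball x _ xpq (lt_nbhsr mx).
have [r2 r20 yr2] := near_ball y _ ypq (lt_nbhsl ym).
(* One radius for both points, strictly below [r1] and [r2] so that even the closed cubes lie in the
   balls. *)
pose r := Num.min r1 r2 / 2.
have r12 : 0 < Num.min r1 r2 by rewrite lt_min r10.
have r0 : 0 < r by rewrite /r; lra.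
have rr1 : r < r1 by have : Num.min r1 r2 <= r1 by [rewrite ge_min lexx]; rewrite /r; lra.
have rr2 : r < r2 by have : Num.min r1 r2 <= r2 by [rewrite ge_min lexx orbT]; rewrite /r; lra.
have sub_ball (s z : 'rV[R]_d) e : r < e -> ccube s r z -> ball s e z.
  move=> re sz; rewrite box_ball; last lra.
  by move=> i; have := sz i; rewrite !mxE => /andP[? ?]; apply/andP; split; lra.
have corner s e : r < e -> ball s e `<=` box p q ->
    forall i, (p 0 i < s 0 i - r) /\ (s 0 i + r < q 0 i).
  move=> re spq i; split.
    have /(_ i) : box p q (s - const_mx r).
      by apply/spq/(sub_ball _ _ _ re) => k; rewrite !mxE; apply/andP; split; lra.
    by rewrite !mxE => /andP[].
  have /(_ i) : box p q (s + const_mx r).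
    by apply/spq/(sub_ball _ _ _ re) => k; rewrite !mxE; apply/andP; split; lra.
  by rewrite !mxE => /andP[].
have xc := corner x r1 rr1 (fun z h => (xr1 z h).2).
have yc := corner y r2 rr2 (fun z h => (yr2 z h).2).
have ux z : cube x r z -> m < u z.
  by move=> /box_cbox/(sub_ball _ _ _ rr1)/xr1[].
have uy z : cube y r z -> u z < m.
  by move=> /box_cbox/(sub_ball _ _ _ rr2)/yr2[].
have [|f tf Df] := @cube_bump_difference x y j r r0 xy.
  apply: subset_trans pqO => z + i => /(_ i); rewrite !mxE => /andP[h1 h2].
  have [x1 x2] := xc i; have [y1 y2] := yc i; apply/andP; split.
    by apply: lt_le_trans h1; rewrite ltrBrDr lt_min -!ltrBrDr x1.
  by apply: le_lt_trans h2 _; rewrite -ltrBrDr gt_max !ltrBrDr x2.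
have ctest (s : 'rV[R]_d) : (forall i, (p 0 i < s 0 i - r) /\ (s 0 i + r < q 0 i)) ->
    test_function Omega (cube_bump s r).
  move=> sc; rewrite cube_bumpE; apply: test_function_bump.
  apply: subset_trans pqO => z + i => /(_ i); rewrite !mxE => /andP[h1 h2].
  by have [h3 h4] := sc i; apply/andP; split; lra.
have LL (s : 'rV[R]_d -> R) : test_function Omega s -> L2 Omega s.
  by move=> ts; exact: (L2_continuousT oO bO (test_function_continuous ts)).
pose w z := (u z - m) * (cube_bump x r z - cube_bump y r z).
have LD : L2 Omega (fun z => cube_bump x r z - cube_bump y r z).
  rewrite (_ : (fun z => _) = fun z => -1 * cube_bump y r z + cube_bump x r z).
    by apply: L2_lin => //; apply: LL; exact: ctest.
  by apply/funext => z; rewrite mulN1r addrC.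
have Lum : L2 Omega (fun z => u z - m).
  rewrite (_ : (fun z => _) = fun z => 1 * u z + (- m)); last first.
    by apply/funext => z; rewrite mul1r.
  by apply: L2_lin => //; exact: L2_cst.
have iw : mu.-integrable Omega (EFin \o w) by exact: L2_integrable_mul.
(* The level [m] may be subtracted from [u] because the derivative of a test function has zero
   integral. *)
have w0 : \int[mu]_(z in Omega) w z = 0.
  have -> : \int[mu]_(z in Omega) w z =
      \int[mu]_(z in Omega) (u z * 'D_(delta_mx 0 j) f z) +
      (- m) * \int[mu]_(z in Omega) 'D_(delta_mx 0 j) f z.
    under [X in X + _]eq_Rintegral do rewrite Df.
    under [X in _ * X]eq_Rintegral do rewrite Df.
    rewrite -RintegralZl//; last exact: L2_integrable.
    rewrite -RintegralD//; last 2 first.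
    - exact: (L2_integrable_mul oO Lu LD).
    - exact: (integrableZl mO (-m) (L2_integrable oO bO LD)).
    by apply: eq_Rintegral => z _; rewrite /w mulrDl.
  by rewrite uD// (test_function_derive bO j tf).2 mulr0 addr0.
have bump0 (s z : 'rV[R]_d) : ~ cube s r z -> cube_bump s r z = 0.
  by move=> sz; rewrite cube_bumpE bump_eq0.
have wge0 z : 0 <= w z.
  rewrite /w; have [xz|xz] := pselect (cube x r z).
    rewrite [X in _ * (_ - X)]bump0 ?subr0; last by move=> /uy; have := ux z xz; lra.
    by rewrite mulr_ge0//; [have := ux z xz; lra|rewrite cube_bumpE; exact: bump_ge0].
  rewrite (bump0 x)// sub0r; have [yz|yz] := pselect (cube y r z).
    rewrite mulrN -mulNr mulr_ge0//; first by have := uy z yz; lra.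
    by rewrite cube_bumpE; exact: bump_ge0.
  by rewrite bump0// oppr0 mulr0.
have [+ _] := @ae_eq_integral_abs _ _ _ mu Omega mO _ (measurable_int _ iw).
have wE : (\int[mu]_(z in Omega) `|(EFin \o w) z| = 0)%E.
  rewrite -[RHS](Rintegral_eq0 oO iw w0); apply: eq_integral => z _ /=.
  by rewrite ger0_norm.
move=> /(_ wE)[N [mN N0 wN]].
have cN : cube x r `<=` N.
  move=> z xz; apply: wN => /= h; have /h : Omega z.
    by apply: pqO; have /box_cbox/(sub_ball _ _ _ rr1)/xr1[] := xz.
  move=> [] /eqP; rewrite /w [X in _ * (_ - X)]bump0 ?subr0; last first.
    by move=> /uy; have := ux z xz; lra.
  rewrite mulf_eq0 => /orP[/eqP|/eqP]; first by have := ux z xz; lra.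
  by have := @bump_gt0 R d _ _ 1%N z isT xz; rewrite -cube_bumpE; lra.
have : (mu (cube x r) <= mu N)%E.
  by apply: le_measure; rewrite ?inE//; exact: measurable_box.
rewrite N0 lebesgue_rV_box => [|i]; last by rewrite !mxE; lra.
rewrite lee_fin leNgt => /negP; apply; apply: prodr_gt0 => i _.
by rewrite !mxE; lra.
Qed.

Definition zero_weak_grad (u : 'rV[R]_d -> R) := forall f j, test_function Omega f ->
  \int[mu]_(z in Omega) (u z * 'D_(delta_mx 0 j) f z) = 0.

(** The points [z k] take their first k coordinates from y and the others from x, so consecutive
    ones differ in one coordinate only and all remain in the box. Each step is used in both
    directions. *)
Lemma zero_weak_grad_box (u : 'rV[R]_d -> R) p q : {within Omega, continuous u} ->
  L2 Omega u -> zero_weak_grad u -> box p q `<=` Omega ->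
  forall x y, box p q x -> box p q y -> u x = u y.
Proof.
move=> cu Lu uD pqO x y xpq ypq.
pose z k : 'rV[R]_d := \row_i (if (i < k)%N then y 0 i else x 0 i).
have zpq k : box p q (z k) by move=> i; rewrite mxE; case: ifP.
suff zk k : (k <= d)%N -> u (z k) = u x.
  rewrite -(zk d)//; congr u; apply/rowP => i; by rewrite mxE ltn_ord.
elim: k => [_|k IHk kd]; first by congr u; apply/rowP => i; rewrite mxE.
rewrite -IHk ?(ltnW kd)//; pose j := Ordinal kd.
have zz i : i != j -> z k.+1 0 i = z k 0 i.
  move=> ij; rewrite !mxE ltnS leq_eqVlt.
  by have /negbTE -> : (i : nat) != k by apply: contra ij => /eqP ik; apply/eqP/val_inj.
apply/eqP; rewrite eq_le; apply/andP; split.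
  by apply: (@zero_weak_grad_step u _ _ j p q) => // f; exact: uD.
by apply: (@zero_weak_grad_step u _ _ j p q) => // [f|i ij]; [exact: uD|rewrite zz].
Qed.

Lemma zero_weak_grad_constant (u : 'rV[R]_d -> R) : connected Omega ->
  {within closure Omega, continuous u} -> zero_weak_grad u ->
  forall x y, closure Omega x -> closure Omega y -> u x = u y.
Proof.
move=> connO cu uD; have Lu := L2_continuous oO bO cu.
have cuO : {within Omega, continuous u}.
  exact: continuous_subspaceW (@subset_closure _ Omega) cu.
have loc x : Omega x -> exists2 e : R, 0 < e &
    ball x e `<=` Omega `&` [set y | u y = u x].
  move=> Ox; have [e /= e0 eO] := (nbhs_ballP _ _).1 (open_nbhs_nbhs (conj oO Ox)).
  exists e => // y; rewrite box_ball// => xy; split; first by apply: eO; rewrite box_ball.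
  apply: (zero_weak_grad_box cuO Lu uD (p := x - const_mx e) (q := x + const_mx e)) => //.
    by rewrite -box_ball.
  by move=> i; rewrite !mxE; apply/andP; split; lra.
(* Local constancy makes the preimage of an arbitrary [S] open; a value and its complement then give
   a set both open and closed in [Omega]. *)
have opn (S : set R) : open (Omega `&` [set y | S (u y)]).
  rewrite openE => x [Ox Sx]; have [e e0 xe] := loc x Ox.
  by apply/nbhs_ballP; exists e => // y /xe[Oy uyx]; split => //=; rewrite uyx.
have cst x y : Omega x -> Omega y -> u x = u y.
  move=> Ox Oy; have E : Omega `&` [set z | u z = u x] = Omega.
    apply: connO; first by exists x.
    - exists (Omega `&` [set z | u z = u x]); first exact: opn [set t | t = u x].
      by rewrite setIA setIid.
    - exists (~` (Omega `&` [set z | u z <> u x])).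
        exact: open_closedC (opn [set t | t <> u x]).
      apply/seteqP; split => z [Oz /= zx]; split => //; first by move=> [].
      by apply: contrapT => nzx; apply: zx.
  by have [] : (Omega `&` [set z | u z = u x]) y by rewrite E.
(* Continuity up to the boundary carries the constant over: a point of the closure with another
   value would have a neighbourhood missing it, yet meeting [Omega]. *)
suff cl x y : closure Omega x -> Omega y -> u x = u y.
  move=> x y cx cy; have [z [Oz _]] := cx setT filterT.
  by rewrite (cl x z)// (cl y z).
move=> cx Oy; apply: contrapT => /eqP xy.
have /subspace_continuousP/(_ x cx) ux := cu.
have W : nbhs (u x) [set t | t <> u y].
  apply/nbhs_ballP; exists `|u x - u y|; first by rewrite /= normr_gt0 subr_eq0.
  by move=> t /= + tuy; rewrite /ball/= tuy ltxx.
have [z [Oz zy]] := cx _ (ux _ W).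
by apply: (zy (subset_closure Oz)); exact: cst.
Qed.

End zero_weak_gradient.

(** * Minimization of exponential sums *)

Section exponential_coercive.
Context {R : realType}.

(* For t >= 0, use the tangent of exp at the point where its slope is 2c. *)
Lemma expR_sub_linear_coercive (c e : R) : 0 < c ->
  exists C, forall t, c * `|t| - C <= expR (t + e) - c * t.
Proof.
move=> c0; exists `|2 * c * (1 + e - ln (2 * c))| => t.
have c20 : 0 < 2 * c by lra.
have [t0|t0] := ger0P t; last first.
  by have := expR_ge0 (t + e); have := normr_ge0 (2 * c * (1 + e - ln (2 * c))); lra.
have -> : expR (t + e) = 2 * c * expR (t + e - ln (2 * c)).
  by rewrite expRB lnK ?posrE// mulrC divfK// gt_eqF.
have h : 2 * c * (1 + (t + e - ln (2 * c))) <= 2 * c * expR (t + e - ln (2 * c)).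
  by rewrite ler_pM2l// expR_ge1Dx.
have := lerNnormlW (lexx `|2 * c * (1 + e - ln (2 * c))|).
by move: h; lra.
Qed.

End exponential_coercive.

Section minimization.
Context {R : realType}.

Definition linear_form {V : lmodType R} (l : V -> R) :=
  forall a x y, l (a *: x + y) = a * l x + l y.

Lemma linear_form0 {V : lmodType R} (l : V -> R) : linear_form l -> l 0 = 0.
Proof.
move=> hl; have := hl 1 0 0; rewrite scaler0 addr0 mul1r => h.
by apply: (addrI (l 0)); rewrite addr0.
Qed.

Lemma linear_formZ {V : lmodType R} (l : V -> R) : linear_form l -> forall a x, l (a *: x) = a * l x.
Proof. by move=> hl a x; rewrite -[a *: x]addr0 hl linear_form0// addr0. Qed.

Lemma linear_form_sum {V : lmodType R} (l : V -> R) (I : Type) (s : seq I) (F : I -> V) :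
  linear_form l -> l (\sum_(i <- s) F i) = \sum_(i <- s) l (F i).
Proof.
move=> hl; elim: s => [|i s IHs]; first by rewrite !big_nil linear_form0.
by rewrite !big_cons -[F i]scale1r hl IHs mul1r scale1r.
Qed.

Lemma continuous_sum (T : topologicalType) (I : Type) (s : seq I) (F : I -> T -> R) :
  (forall i, continuous (F i)) -> continuous (fun x => \sum_(i <- s) F i x).
Proof.
move=> cF; elim: s => [|i s IHs].
  rewrite (_ : (fun x => _) = cst 0); first exact: cst_continuous.
  by apply/funext => x; rewrite big_nil.
rewrite (_ : (fun x => _) = fun x => F i x + \sum_(i <- s) F i x); last first.
  by apply/funext => x; rewrite big_cons.
by move=> x; exact: (continuousD (cF i x) (IHs x)).
Qed.

Lemma linear_form_continuous n (l : 'rV[R]_n -> R) : linear_form l -> continuous l.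
Proof.
move=> hl.
rewrite (_ : l = fun x : 'rV[R]_n => \sum_j x 0 j * l (delta_mx 0 j)); last first.
  apply/funext => x; rewrite [in LHS](row_sum_delta x) (linear_form_sum _ _ hl).
  by apply: eq_bigr => j _; rewrite linear_formZ.
apply: continuous_sum => j x.
apply: (@continuousM _ _ (fun x : 'rV[R]_n => x 0 j) (cst (l (delta_mx 0 j)))).
  exact: coord_continuous.
exact: cst_continuous.
Qed.

Lemma bilinear_diag_continuous n (B : 'rV[R]_n -> 'rV[R]_n -> R) :
  (forall y, linear_form (B ^~ y)) -> (forall x, linear_form (B x)) -> continuous (fun x => B x x).
Proof.
move=> h1 h2; rewrite (_ : (fun x => _) =
    fun x : 'rV[R]_n => \sum_j x 0 j * B (delta_mx 0 j) x); last first.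
  apply/funext => x; rewrite [X in B X _](row_sum_delta x) (linear_form_sum _ _ (h1 x)).
  by apply: eq_bigr => j _; rewrite (linear_formZ (h1 x)).
apply: continuous_sum => j x.
apply: (@continuousM _ _ (fun x : 'rV[R]_n => x 0 j) (B (delta_mx 0 j))).
  exact: coord_continuous.
exact: linear_form_continuous.
Qed.

Variables (K : finType) (b c e : K -> R).
Hypotheses (b0 : forall k, 0 < b k) (c0 : forall k, 0 < c k).

Section rV.
Variables (n : nat) (l : K -> 'rV[R]_n -> R) (B : 'rV[R]_n -> 'rV[R]_n -> R).
Hypotheses (hl : forall k, linear_form (l k)) (hB : forall y, linear_form (B ^~ y)).
Hypotheses (Bsym : forall x y, B x y = B y x) (B0 : forall x, 0 <= B x x).
Hypothesis nondeg : forall x, (forall k, l k x = 0) -> B x x = 0 -> x = 0.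

Let hB2 x : linear_form (B x).
Proof. by move=> a y z; rewrite ![B x _]Bsym (hB x). Qed.

Let G x := \sum_k b k * (expR (l k x + e k) - c k * l k x) + 2^-1 * B x x.
(** The gauge of growth for [G]: it grows linearly along the forms [l k] and quadratically through
    [B]. Neither term need control x alone; [nondeg] says that together they do. *)
Let Q x := \sum_k `|l k x| + B x x.

Let cQ : continuous Q.
Proof.
move=> x; apply: (@continuousD _ _ _ (fun x => \sum_k `|l k x|) (fun x => B x x)).
  apply: continuous_sum => k y.
  apply: (@continuous_comp _ _ _ (l k) (fun t : R => `|t|)); last exact: norm_continuous.
  exact: linear_form_continuous.
exact: bilinear_diag_continuous.
Qed.

Let cG : continuous G.
Proof.
move=> x; apply: (@continuousD _ _ _
  (fun x => \sum_k b k * (expR (l k x + e k) - c k * l k x))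
  (fun x => 2^-1 * B x x)).
  apply: continuous_sum => k {}x.
  apply: (@continuousM _ _ (cst (b k)) (fun x => expR (l k x + e k) - c k * l k x)).
    exact: cst_continuous.
  apply: (@continuousB _ _ _ (fun x => expR (l k x + e k)) (fun x => c k * l k x)).
    apply: (@continuous_comp _ _ _ (fun x => l k x + e k) expR); last exact: continuous_expR.
    apply: (@continuousD _ _ _ (l k) (cst (e k))); last exact: cst_continuous.
    exact: linear_form_continuous.
  apply: (@continuousM _ _ (cst (c k)) (l k)); first exact: cst_continuous.
  exact: linear_form_continuous.
apply: (@continuousM _ _ (cst (2^-1)) (fun x => B x x)).
  exact: cst_continuous.
exact: bilinear_diag_continuous.
Qed.

Let Q_gt0 x : x != 0 -> 0 < Q x.
Proof.
move=> x0; rewrite lt_neqAle addr_ge0 ?sumr_ge0// andbT.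
apply: contra x0; rewrite eq_sym paddr_eq0 ?sumr_ge0// => /andP[+ /eqP Bx].
rewrite psumr_eq0// => /allP lx; apply/eqP/nondeg => // k.
by have /eqP/normr0_eq0 := lx k (mem_index_enum k).
Qed.

(* On |x| >= 1 the quadratic part grows at least linearly, so it is enough to
   bound Q from below on the unit sphere. *)
Let Q_linear : exists2 delta, 0 < delta & forall x, 1 <= `|x| -> delta * `|x| <= Q x.
Proof.
pose S := [set x : 'rV[R]_n | `|x| = 1].
have cS : compact S.
  apply: bounded_closed_compact.
    by exists 1; split; rewrite ?num_real// => M M1 x /= ->; exact: ltW.
  rewrite (_ : S = Num.norm @^-1` [set t : R | t = 1])//.
  apply: preimage_closed; last exact: closed_eq.
  by move=> x _; exact: norm_continuous.
have [delta d0 Sd] : exists2 delta, 0 < delta & forall x, S x -> delta <= Q x.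
  (* The unit sphere is empty in dimension 0, where any positive constant serves. *)
  have [S0|S0] := pselect (S !=set0); last first.
    by exists 1 => // x Sx; exfalso; apply: S0; exists x.
  have [z zS Qz] := EVT_min_rV S0 cS (continuous_subspaceT cQ).
  exists (Q z); last by move=> x Sx; apply: Qz; rewrite inE.
  apply: Q_gt0; rewrite -normr_gt0; move: zS; rewrite inE/= => ->; exact: ltr01.
exists delta => // x x1; have x0 : 0 < `|x| by exact: lt_le_trans x1.
pose y := `|x|^-1 *: x.
have xy : x = `|x| *: y by rewrite scalerA mulfV ?scale1r// gt_eqF.
have Sy : S y by rewrite /S/= normrZ normfV normr_id mulVf// gt_eqF.
rewrite [X in _ <= Q X]xy /Q.
have -> : B (`|x| *: y) (`|x| *: y) = `|x| * (`|x| * B y y).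
  by rewrite (linear_formZ (hB _)) (linear_formZ (@hB2 _)).
have -> : \sum_k `|l k (`|x| *: y)| = `|x| * \sum_k `|l k y|.
  by rewrite mulr_sumr; apply: eq_bigr => k _; rewrite linear_formZ// normrM normr_id.
rewrite -mulrDr mulrC ler_pM2l// (le_trans (Sd _ Sy))// lerD2l.
by rewrite ler_peMl.
Qed.

Let G_coercive : exists kappa C, 0 < kappa /\ forall x, kappa * Q x - C <= G x.
Proof.
have hC k : {C | forall t, c k * `|t| - C <= expR (t + e k) - c k * t}.
  by apply: cid; exact: expR_sub_linear_coercive.
(* The comparison is term by term: b k * c k comes from the k-th exponential term, 1/2 from the
   quadratic part. *)
pose kappa := \big[Num.min/2^-1]_k (b k * c k).
exists kappa, (\sum_k b k * sval (hC k)); split.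
  by apply: lt_bigmin => // k _; exact: mulr_gt0.
move=> x; rewrite /Q /G mulrDr mulr_sumr addrAC -sumrB lerD//.
  apply: ler_sum => k _; case: (hC k) => C /= /(_ (l k x)) h.
  apply: (@le_trans _ _ (b k * (c k * `|l k x| - C))); last by rewrite ler_pM2l.
  by rewrite mulrBr lerB// mulrA ler_wpM2r// bigmin_le_cond.
by rewrite ler_wpM2r// bigmin_le_id.
Qed.

Let G_min : exists y, forall x, G y <= G x.
Proof.
have [delta d0 dQ] := Q_linear; have [kappa [C [k0 GQ]]] := G_coercive.
(* Beyond this radius kappa * delta * |x| - C exceeds G 0, so a minimizer over the ball is global;
   the 1 puts the exterior in the range of [Q_linear]. *)
pose rho := Num.max 1 ((G 0 + C) / (kappa * delta)).
pose S := [set x : 'rV[R]_n | `|x| <= rho].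
have cS : compact S.
  apply: bounded_closed_compact.
    by exists rho; split; rewrite ?num_real// => M M1 x /= xr; rewrite (le_trans xr)// ltW.
  rewrite (_ : S = Num.norm @^-1` [set t : R | t <= rho])//.
  apply: preimage_closed; last exact: closed_le.
  by move=> x _; exact: norm_continuous.
have S0 : S 0 by rewrite /S/= normr0 /rho le_max ler01.
have [y yS Gy] := EVT_min_rV (ex_intro _ _ S0) cS (continuous_subspaceT cG).
exists y => x; have [xr|rx] := leP `|x| rho; first by apply: Gy; rewrite inE.
apply: (@le_trans _ _ (G 0)); first by apply: Gy; rewrite inE.
apply: le_trans (GQ x); rewrite lerBrDr.
have x1 : 1 <= `|x| by apply: ltW; apply: le_lt_trans rx; rewrite le_max lexx.
apply: (@le_trans _ _ (kappa * (delta * `|x|))); last by rewrite ler_pM2l// dQ.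
rewrite mulrA mulrC -ler_pdivrMr ?mulr_gt0//.
by apply: ltW; apply: le_lt_trans rx; rewrite le_max lexx orbT.
Qed.

(** Fermat's rule at t = 0 for the restriction of [G] to the line t h + y through a minimizer y. *)
Lemma exp_form_equation_rV : exists y, forall h,
  \sum_k b k * (expR (l k y + e k) - c k) * l k h + B y h = 0.
Proof.
have [y yG] := G_min; exists y => h.
pose phi t := G (t *: h + y).
pose F k t := b k * (expR (t * l k h + l k y + e k) - c k * (t * l k h + l k y)).
pose q t := 2^-1 * (B y y + 2 * t * B y h + t * t * B h h).
have phiE t : phi t = \sum_k F k t + q t.
  rewrite /phi /G; congr (_ + _); first by apply: eq_bigr => k _; rewrite hl.
  by rewrite (hB _) !(@hB2 _) [B h y]Bsym /q; ring.
have ds (m p t : R) : is_derive t (1 : R) (fun t : R => t * m + p) m.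
  by apply: is_derive_eq; rewrite scaler0 add0r addr0 [_ *: _]mulr1.
have dF k t : is_derive t (1 : R) (F k)
    (b k * (expR (t * l k h + l k y + e k) - c k) * l k h).
  have d1 := ds (l k h) (l k y) t.
  have d2 : is_derive t (1 : R) (fun t => t * l k h + l k y + e k) (l k h).
    rewrite (_ : (fun t => _) = fun t => t * l k h + (l k y + e k)); first exact: ds.
    by apply/funext => u; rewrite addrA.
  have d3 := @is_derive1_comp R expR _ t _ _ (is_derive_expR _) d2.
  have d4 := is_deriveM (is_derive_cst (b k) t (1 : R))
    (is_deriveB d3 (is_deriveM (is_derive_cst (c k) t (1 : R)) d1)).
  move: d4; rewrite !scaler0 !addr0; congr (is_derive _ _ _ _).
  by rewrite /GRing.scale/=; ring.
have dq t : is_derive t (1 : R) q (B y h + t * B h h).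
  have d1 := ds (B y h) 0 t.
  have d2 := is_deriveM (is_derive_id t (1 : R)) (is_derive_id t (1 : R)).
  have d3 := is_deriveD (is_derive_cst (2^-1 * B y y) t (1 : R)) (is_deriveD d1
    (is_deriveM (is_derive_cst (2^-1 * B h h) t (1 : R)) d2)).
  have qE : q = fun t => 2^-1 * B y y + ((t * B y h + 0) + 2^-1 * B h h * (t * t)).
    by apply/funext => u; rewrite /q; field.
  rewrite qE; move: d3; congr (is_derive _ _ _ _).
  by rewrite /GRing.scale/=; field.
have dS (s : seq K) t : is_derive t (1 : R) (fun t => \sum_(k <- s) F k t)
    (\sum_(k <- s) b k * (expR (t * l k h + l k y + e k) - c k) * l k h).
  elim: s => [|k s IHs].
    rewrite big_nil (_ : (fun t => _) = cst 0); first exact: is_derive_cst.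
    by apply/funext => u; rewrite big_nil.
  rewrite big_cons (_ : (fun t => _) = fun t => F k t + \sum_(k <- s) F k t).
    exact: is_deriveD (dF k t) IHs.
  by apply/funext => u; rewrite big_cons.
have dphi t : is_derive t (1 : R) phi
    (\sum_k b k * (expR (t * l k h + l k y + e k) - c k) * l k h + (B y h + t * B h h)).
  rewrite (_ : phi = fun t => \sum_k F k t + q t); last exact/funext.
  exact: is_deriveD (dS _ t) (dq t).
have [_ phi0] : is_derive 0 (1 : R) phi 0.
  apply: (@derive1_at_min R phi (-1) 1 0).
  - lra.
  - by move=> t _; case: (dphi t).
  - by rewrite in_itv/=; apply/andP; split; lra.
  - by move=> t _; rewrite {1}/phi scale0r add0r; exact: yG.
have [_] := dphi 0; rewrite phi0 mul0r addr0 => h0; rewrite [RHS]h0.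
congr (_ + _); apply: eq_bigr => k _.
by rewrite mul0r add0r.
Qed.

End rV.

Import VectorInternalTheory.

(** The compactness argument needs the norm of row vectors; coordinates in a basis of [V] transport
    the forms there and the minimizer back. *)
Lemma exp_form_equation (V : vectType R) (l : K -> V -> R) (B : V -> V -> R) :
  (forall k, linear_form (l k)) -> (forall y, linear_form (B ^~ y)) ->
  (forall x y, B x y = B y x) -> (forall x, 0 <= B x x) ->
  (forall x, (forall k, l k x = 0) -> B x x = 0 -> x = 0) ->
  exists y, forall h,
    \sum_k b k * (expR (l k y + e k) - c k) * l k h + B y h = 0.
Proof.
move=> hl hB Bsym B0 nondeg.
pose l' k x := l k (r2v x); pose B' x y := B (r2v x) (r2v y).
have [|||||y hy] := @exp_form_equation_rV (dim V) l' B'.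
- by move=> k a x y; rewrite /l' linearP hl.
- by move=> z a x y; rewrite /B' linearP hB.
- by move=> x y; exact: Bsym.
- by move=> x; exact: B0.
- move=> x lx Bx; apply: (can_inj r2vK); rewrite linear0; exact: nondeg.
by exists (r2v y) => h; have := hy (v2r h); rewrite /l' /B' v2rK.
Qed.

End minimization.

(** * Galerkin spaces and quadrature *)

Section grad_within.
Context {R : realType} {d : nat}.
Implicit Types (K : set 'rV[R]_d) (z g h : 'rV[R]_d) (u v : 'rV[R]_d -> R).

Lemma dotv_linl a g h w : dotv (a *: g + h) w = a * dotv g w + dotv h w :> R.
Proof.
rewrite /dotv mulr_sumr -big_split; apply: eq_bigr => j _ /=.
by rewrite !mxE mulrDl mulrA.
Qed.

Lemma dotvZl a g w : dotv (a *: g) w = a * dotv g w :> R.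
Proof. by rewrite /dotv mulr_sumr; apply: eq_bigr => j _; rewrite !mxE mulrA. Qed.

Lemma dotvC g h : dotv g h = dotv h g.
Proof. by apply: eq_bigr => j _; rewrite mulrC. Qed.

Lemma dotv_ge0 g : 0 <= dotv g g.
Proof. by apply: sumr_ge0 => j _; rewrite -expr2 sqr_ge0. Qed.

Lemma is_grad_within_lin K z a u v g h : is_grad_within K z u g -> is_grad_within K z v h ->
  is_grad_within K z (fun x => a * u x + v x) (a *: g + h).
Proof.
rewrite /is_grad_within => ug vh.
rewrite (_ : (fun x => _) = (fun x => a * ((u x - u z - dotv g (x - z)) / `|x - z|) +
   (v x - v z - dotv h (x - z)) / `|x - z|)); last first.
  by apply/funext => x; rewrite dotv_linl; ring.
rewrite (_ : nbhs (0 : R) = nbhs (a * 0 + 0 : R)); last by rewrite mulr0 addr0.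
apply: cvgD; last exact: vh.
by apply: cvgM; [exact: cvg_cst|exact: ug].
Qed.

Lemma is_grad_within_cst K z (c : R) : is_grad_within K z (fun=> c) 0.
Proof.
rewrite /is_grad_within.
rewrite (_ : (fun x : 'rV[R]_d => (c - c - dotv 0 (x - z)) / `|x - z|) = cst 0).
  exact: cvg_cst.
apply/funext => x; rewrite subrr sub0r /dotv big1 ?oppr0 ?mul0r// => j _.
by rewrite mxE mul0r.
Qed.

Lemma is_grad_within_eq K z u v g : K z -> {in K, u =1 v} ->
  is_grad_within K z u g -> is_grad_within K z v g.
Proof.
move=> Kz uv; rewrite /is_grad_within => ug W W0.
apply: (@filterS _ (z^') (dnbhs_filter z) _ _ _ (ug W W0)) => x /= xW Kx.
by have := xW Kx; rewrite !uv ?inE.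
Qed.

End grad_within.

(** * Interpolation, quadrature sums and the discrete diffusion form *)

Section galerkin.
Context {R : realType} {d : nat} {Omega : set 'rV[R]_d}.
Context {Q : quadrature Omega} {X : set ('rV[R]_d -> R)}.
Hypotheses (hOmega : bounded_domain Omega) (hX : galerkin_space Q X).
Implicit Types (u v w : 'rV[R]_d -> R) (z : 'rV[R]_d).

Let oO : open Omega. Proof. by case: hOmega. Qed.
Let bO : bounded_set Omega. Proof. by case: hOmega. Qed.

Lemma mem_nodeset e z : z \in @nodes _ _ _ Q e -> z \in nodeset Q.
Proof. by move=> ze; apply/bigfcupP; exists e => //; rewrite mem_index_enum. Qed.

Lemma nodesetP z : z \in nodeset Q -> exists e, z \in @nodes _ _ _ Q e.
Proof. by move=> /bigfcupP[e _ ze]; exists e. Qed.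

Lemma cell_closure e : @cell _ _ _ Q e `<=` closure Omega.
Proof. by rewrite -(cell_cover Q) => x ex; exists e. Qed.

Lemma node_closure z : z \in nodeset Q -> closure Omega z.
Proof. by move=> /nodesetP[e ze]; apply: (@cell_closure e); exact: nodes_cell. Qed.

Lemma galerkin_sum (I : eqType) (s : seq I) (a : I -> R) (F : I -> 'rV[R]_d -> R) :
  (forall i, i \in s -> X (F i)) -> X (fun x => \sum_(i <- s) a i * F i x).
Proof.
elim: s => [_|i s IHs sF].
  rewrite (_ : (fun x => _) = fun=> 0); first exact: (gs_cst hX).
  by apply/funext => x; rewrite big_nil.
rewrite (_ : (fun x => _) = fun x => a i * F i x + \sum_(i <- s) a i * F i x); last first.
  by apply/funext => x; rewrite big_cons.
apply: (gs_lin hX); first by apply: sF; rewrite mem_head.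
by apply: IHs => k ks; apply: sF; rewrite in_cons ks orbT.
Qed.

Lemma nodal_basisP z : z \in nodeset Q -> is_nodal Q X z (nodal_basis Q X z).
Proof.
move=> zQ; have [psi [psiz _]] := gs_nodal hX zQ.
exact: (xgetPex _ (ex_intro _ psi psiz)).
Qed.

Lemma interp_galerkin f : X (interp Q X f).
Proof. by apply: galerkin_sum => z /nodal_basisP[]. Qed.

Lemma interpE f z : z \in nodeset Q -> interp Q X f z = f z.
Proof.
move=> zQ; rewrite /interp (big_rem z)//= (nodal_basisP zQ).2// eqxx mulr1.
rewrite big_seq big1 ?addr0// => y; rewrite mem_rem_uniq ?fset_uniq// => /andP[yz yQ].
by rewrite (nodal_basisP yQ).2// (negbTE yz) mulr0.
Qed.

Lemma eq_interp f f' : (forall z, z \in nodeset Q -> f z = f' z) ->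
  interp Q X f = interp Q X f'.
Proof.
move=> ff'; apply/funext => x; rewrite /interp.
by apply: eq_big_seq => z zQ; rewrite ff'.
Qed.

Lemma interp_lin a f f' :
  interp Q X (fun z => a * f z + f' z) = fun x => a * interp Q X f x + interp Q X f' x.
Proof.
apply/funext => x; rewrite /interp mulr_sumr -big_split; apply: eq_bigr => z _ /=.
by rewrite mulrDl mulrA.
Qed.

(** Adding u - v to a nodal function leaves its nodal values unchanged, so uniqueness of nodal
    functions forces u - v to vanish. Some node exists because the quadrature is not empty. *)
Lemma galerkin_nodes_eq u v : X u -> X v -> (forall z, z \in nodeset Q -> u z = v z) ->
  {in closure Omega, u =1 v}.
Proof.
move=> Xu Xv uv x xO.
have [e [z /mem_nodeset zQ]] := nodes_neq0 Q.
have [psi [_ psiU]] := gs_nodal hX zQ.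
have [Xb zb] := nodal_basisP zQ.
have h1 := psiU _ (nodal_basisP zQ) x xO.
have : is_nodal Q X z (fun x => 1 * (fun x => - 1 * v x + u x) x + nodal_basis Q X z x).
  split; first by apply: (gs_lin hX) => //; exact: (gs_lin hX).
  by move=> y yQ; rewrite zb// uv// mulN1r addNr mulr0 add0r.
move=> /psiU/(_ x xO); rewrite h1 mul1r => /eqP.
by rewrite -subr_eq subrr eq_sym mulN1r addrC subr_eq0 => /eqP.
Qed.

(** Lumping the weights of a shared node turns the cellwise product into one sum over distinct
    nodes. Gradients differ from cell to cell, so the diffusion form is not lumped. *)
Definition node_weight z : R := \sum_(e : elem Q | z \in nodes e) weight e z.

Lemma node_weight_gt0 z : z \in nodeset Q -> 0 < node_weight z.
Proof.
move=> /nodesetP[e ze]; rewrite /node_weight (bigD1 e)//=.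
by rewrite ltr_pwDl ?weight_gt0// sumr_ge0// => k /andP[zk _]; rewrite ltW// weight_gt0.
Qed.

Lemma disc_innerE u v :
  disc_inner Q u v = \sum_(z <- nodeset Q) node_weight z * (u z * v z).
Proof.
rewrite /disc_inner /node_weight.
transitivity (\sum_(e : elem Q) \sum_(z <- nodeset Q | z \in nodes e)
    weight e z * (u z * v z)).
  apply: eq_bigr => e _; rewrite -[RHS]big_filter; apply: perm_big; apply: uniq_perm.
  - exact: fset_uniq.
  - exact/filter_uniq/fset_uniq.
  - move=> z; rewrite mem_filter; case: (boolP (z \in nodes e)) => //= ze.
    by rewrite (mem_nodeset ze).
rewrite (exchange_big_dep predT)//=; apply: eq_bigr => z _.
by rewrite mulr_suml.
Qed.

Lemma eq_disc_inner u u' v v' : (forall z, z \in nodeset Q -> u z * v z = u' z * v' z) ->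
  disc_inner Q u v = disc_inner Q u' v'.
Proof. by move=> h; rewrite !disc_innerE; apply: eq_big_seq => z zQ; rewrite h. Qed.

Lemma disc_inner_linl a u v w :
  disc_inner Q (fun x => a * u x + v x) w = a * disc_inner Q u w + disc_inner Q v w.
Proof.
rewrite !disc_innerE mulr_sumr -big_split; apply: eq_bigr => z _ /=; ring.
Qed.

Lemma disc_innerC u v : disc_inner Q u v = disc_inner Q v u.
Proof. by apply: eq_disc_inner => z _; rewrite mulrC. Qed.

Lemma disc_inner_ge0 u v : (forall z, z \in nodeset Q -> 0 <= u z * v z) ->
  0 <= disc_inner Q u v.
Proof.
move=> uv; rewrite disc_innerE big_seq; apply: sumr_ge0 => z zQ.
by rewrite mulr_ge0 ?uv// ltW// node_weight_gt0.
Qed.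

Lemma disc_inner_eq0 u v : (forall z, z \in nodeset Q -> 0 <= u z * v z) ->
  disc_inner Q u v = 0 -> forall z, z \in nodeset Q -> u z * v z = 0.
Proof.
move=> uv /eqP; rewrite disc_innerE big_seq psumr_eq0; last first.
  by move=> z zQ; rewrite mulr_ge0 ?uv// ltW// node_weight_gt0.
move=> /allP h z zQ; have := h z zQ; rewrite zQ/= mulf_eq0 => /orP[/eqP z0|/eqP//].
by have := node_weight_gt0 zQ; rewrite z0 ltxx.
Qed.

Lemma disc_gradP u e z : X u -> z \in @nodes _ _ _ Q e ->
  is_grad_within (cell e) z u (disc_grad u e z).
Proof.
move=> Xu ze; have [g [ug _]] := gs_grad hX Xu ze.
exact: (xgetPex _ (ex_intro _ g ug)).
Qed.

Lemma disc_grad_unique u e z g : X u -> z \in @nodes _ _ _ Q e ->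
  is_grad_within (cell e) z u g -> disc_grad u e z = g.
Proof.
move=> Xu ze ug; have [h [_ hU]] := gs_grad hX Xu ze.
by rewrite -(hU _ ug) (hU _ (disc_gradP Xu ze)).
Qed.

Lemma disc_grad_lin a u v e z : X u -> X v -> z \in @nodes _ _ _ Q e ->
  disc_grad (fun x => a * u x + v x) e z = a *: disc_grad u e z + disc_grad v e z.
Proof.
move=> Xu Xv ze; apply: disc_grad_unique => //; first exact: (gs_lin hX).
by apply: is_grad_within_lin; exact: disc_gradP.
Qed.

Lemma disc_grad_cst c e z : z \in @nodes _ _ _ Q e -> disc_grad (fun=> c) e z = 0.
Proof.
by move=> ze; apply: disc_grad_unique => //; [exact: (gs_cst hX)|exact: is_grad_within_cst].
Qed.

Lemma eq_disc_grad u v e z : X u -> X v -> z \in @nodes _ _ _ Q e ->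
  {in closure Omega, u =1 v} -> disc_grad u e z = disc_grad v e z.
Proof.
move=> Xu Xv ze uv; apply: disc_grad_unique => //.
apply: is_grad_within_eq (disc_gradP Xv ze); first exact: nodes_cell.
move=> x; rewrite inE => ex; apply/esym/uv.
by rewrite inE; exact: (@cell_closure e).
Qed.

Section diffusion_form.
Variable k : 'rV[R]_d -> R.

Definition diffusion_form u v : R :=
  disc_innerv (fun e z => k z *: @disc_grad _ _ _ Q u e z) (disc_grad v).

Lemma diffusion_formC u v : diffusion_form u v = diffusion_form v u.
Proof.
apply: eq_bigr => e _; apply: eq_bigr => z _; congr (_ * _).
by rewrite !dotvZl dotvC.
Qed.

Lemma diffusion_form_linl a u v w : X u -> X v ->
  diffusion_form (fun x => a * u x + v x) w =
  a * diffusion_form u w + diffusion_form v w.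
Proof.
move=> Xu Xv; rewrite /diffusion_form /disc_innerv mulr_sumr -big_split.
apply: eq_bigr => e _ /=; rewrite mulr_sumr -big_split; apply: eq_big_seq => z ze /=.
by rewrite disc_grad_lin// !dotvZl dotv_linl; ring.
Qed.

Lemma diffusion_form_cstl c w : diffusion_form (fun=> c) w = 0.
Proof.
rewrite /diffusion_form /disc_innerv big1// => e _; rewrite big_seq big1// => z ze.
rewrite disc_grad_cst// scaler0 /dotv big1 ?mulr0// => j _.
by rewrite mxE mul0r.
Qed.

Lemma eq_diffusion_form u u' v v' : X u -> X u' -> X v -> X v' ->
  {in closure Omega, u =1 u'} -> {in closure Omega, v =1 v'} ->
  diffusion_form u v = diffusion_form u' v'.
Proof.
move=> Xu Xu' Xv Xv' uu vv; apply: eq_bigr => e _; apply: eq_big_seq => z ze.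
by rewrite (eq_disc_grad Xu Xu' ze uu) (eq_disc_grad Xv Xv' ze vv).
Qed.

Lemma diffusion_form_ge0 u : (forall z, z \in nodeset Q -> 0 <= k z) ->
  0 <= diffusion_form u u.
Proof.
move=> k0; apply: sumr_ge0 => e _; rewrite big_seq; apply: sumr_ge0 => z ze.
rewrite mulr_ge0 ?(ltW (weight_gt0 ze))//.
by rewrite dotvZl mulr_ge0 ?dotv_ge0// k0// (mem_nodeset ze).
Qed.

End diffusion_form.

Lemma galerkin_H1 u : X u -> H1 Omega u.
Proof. exact: (gs_H1 hX). Qed.

(** The two predicates handed to [xget] are the same set, so the same representative is chosen and
    the equality holds everywhere. *)
Lemma eq_weak_grad u v : {in Omega, u =1 v} -> weak_grad Omega u = weak_grad Omega v.
Proof.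
move=> uv; congr (xget _ _); apply/seteqP; split => g [Lg ug]; split => // f tf j;
  rewrite -ug//; apply: eq_Rintegral => x xO; by rewrite uv.
Qed.

Lemma eq_grad_form u u' v v' : {in closure Omega, u =1 u'} -> {in closure Omega, v =1 v'} ->
  grad_form (Omega := Omega) u v = grad_form (Omega := Omega) u' v'.
Proof.
move=> uu vv; rewrite /grad_form (@eq_weak_grad u u') ?(@eq_weak_grad v v')// => x;
  by rewrite inE => /subset_closure xO; rewrite ?uu ?vv ?inE.
Qed.

Definition mean u : R := \int[lebesgue_rV d]_(x in Omega) u x.

Lemma mean_lin a u v : X u -> X v -> mean (fun x => a * u x + v x) = a * mean u + mean v.
Proof.
move=> /galerkin_H1[Lu _] /galerkin_H1[Lv _]; have mO := open_rV_measurable oO.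
have iu := L2_integrable oO bO Lu; have iv := L2_integrable oO bO Lv.
by rewrite /mean -RintegralZl// -RintegralD//; exact: (integrableZl mO a iu).
Qed.

(** [Omega] contains a ball and is bounded, so its measure is positive and finite and can be
    cancelled. *)
Lemma mean_constant u k : {in closure Omega, forall x, u x = k} -> mean u = 0 -> k = 0.
Proof.
move=> uk; rewrite /mean (@eq_Rintegral _ _ _ _ _ (fun=> k)); last first.
  by move=> x; rewrite inE => /subset_closure xO; rewrite uk ?inE.
have mO := open_rV_measurable oO.
rewrite Rintegral_cst// => /eqP; rewrite mulf_eq0 => /orP[/eqP//|/eqP m0].
have [_ _ [x Ox] _] := hOmega.
have [e /= e0 eO] := (nbhs_ballP _ _).1 (open_nbhs_nbhs (conj oO Ox)).
have : (0 < lebesgue_rV d Omega)%E.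
  apply: (@lt_le_trans _ _ (lebesgue_rV d (ball x e))); last first.
    apply: le_measure => //; rewrite inE//; apply: open_rV_measurable.
    exact: ball_open.
  rewrite box_ball// lebesgue_rV_box => [|i]; last by rewrite !mxE; lra.
  by rewrite lte_fin prodr_gt0// => i _; rewrite !mxE; lra.
have := lebesgue_rV_domain_lty oO bO.
by move=> loo l0; have := fine_gt0 (introT andP (conj l0 loo)); rewrite m0 ltxx.
Qed.

Lemma grad_form_mean_eq0 u : X u -> grad_form (Omega := Omega) u u = 0 -> mean u = 0 ->
  {in closure Omega, forall x, u x = 0}.
Proof.
move=> Xu u0 mu0 x xO; apply: (@mean_constant u) => // y yO.
have [_ cO _ _] := hOmega; move: xO yO; rewrite !inE => xO yO.
apply: (zero_weak_grad_constant oO bO cO (gs_cont hX Xu)) => // f j tf.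
by apply: (grad_form_eq0 oO bO (galerkin_H1 Xu) u0).
Qed.

End galerkin.

(** * Mass, uniqueness and energy dissipation *)

Section scalar_inequalities.
Context {R : realType}.

(** This is exp s >= 1 + s at s = ln a - ln b, multiplied by b. The slope is taken at a, the new
    concentration, in accordance with the implicit chemical potential. *)
Lemma entropy_convex (a b : R) : 0 < a -> 0 < b ->
  (a * ln a - a) - (b * ln b - b) <= (a - b) * ln a.
Proof.
move=> a0 b0; have := expR_ge1Dx (ln a - ln b).
rewrite expRB !lnK ?posrE// ler_pdivlMr// => h.
by move: h; lra.
Qed.

Lemma ln_sub_mul_ge0 (a b : R) : 0 < a -> 0 < b -> 0 <= (a - b) * (ln a - ln b).
Proof.
move=> a0 b0; have [ab|ba] := leP a b.
  by rewrite mulr_le0// subr_le0// ler_ln ?posrE.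
by rewrite mulr_ge0// subr_ge0 ?ler_ln ?posrE// ltW.
Qed.

Lemma ln_sub_mul_eq0 (a b : R) : 0 < a -> 0 < b -> (a - b) * (ln a - ln b) = 0 -> a = b.
Proof.
move=> a0 b0 /eqP; rewrite mulf_eq0 !subr_eq0 => /orP[/eqP//|/eqP].
by move=> h; apply: ln_inj; rewrite ?posrE.
Qed.

End scalar_inequalities.

Section pnp.
Context {R : realType} {d : nat} {Omega : set 'rV[R]_d}.
Context {Q : quadrature Omega} {X : set ('rV[R]_d -> R)}.
Hypotheses (hOmega : bounded_domain Omega) (hX : galerkin_space Q X).
Context {N : nat} {zeta D : 'I_N -> R} {eps rho0 : R} {phie : 'rV[R]_d -> R} {dt : R}.
Hypotheses (hD : forall i, 0 < D i) (heps : 0 < eps) (hdt : 0 < dt).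
Context {cn : 'I_N -> 'rV[R]_d -> R} {phin : 'rV[R]_d -> R}.
Hypothesis hphin : is_potential Q X zeta eps rho0 cn phin.
Implicit Types (u v w phi : 'rV[R]_d -> R) (c : 'I_N -> 'rV[R]_d -> R).

Let oO : open Omega. Proof. by case: hOmega. Qed.
Let bO : bounded_set Omega. Proof. by case: hOmega. Qed.

Local Notation sol := (is_solution Q X zeta D eps rho0 phie dt cn).
Local Notation mu := (chem_potential Q X zeta phie).
Local Notation ip := (disc_inner Q).
Local Notation gf := (grad_form (Omega := Omega)).
Local Notation charge := (charge_density zeta rho0).

Let A i := diffusion_form (Q := Q) (fun z => D i * cn i z).

Lemma galerkin_sub u v : X u -> X v -> X (fun x => u x - v x).
Proof.
move=> Xu Xv; rewrite (_ : (fun x => _) = fun x => - 1 * v x + u x).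
  exact: (gs_lin hX).
by apply/funext => x; rewrite mulN1r addrC.
Qed.

Lemma disc_inner_subl u v w : ip (fun x => u x - v x) w = ip u w - ip v w.
Proof.
rewrite (_ : (fun x => _) = fun x => - 1 * v x + u x); last first.
  by apply/funext => x; rewrite mulN1r addrC.
by rewrite disc_inner_linl mulN1r addrC.
Qed.

Lemma grad_form_subl u v w : X u -> X v -> X w ->
  gf (fun x => u x - v x) w = gf u w - gf v w.
Proof.
move=> Xu Xv Xw; rewrite (_ : (fun x => _) = fun x => - 1 * v x + u x); last first.
  by apply/funext => x; rewrite mulN1r addrC.
rewrite grad_form_linl//; first by rewrite mulN1r addrC.
all: exact: (galerkin_H1 hX).
Qed.

Lemma grad_form_sub u v : X u -> X v ->
  gf (fun x => u x - v x) (fun x => u x - v x) = gf u u - 2 * gf u v + gf v v.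
Proof.
move=> Xu Xv; have Xuv := galerkin_sub Xu Xv.
rewrite grad_form_subl// [gf u _]grad_form_sym [gf v (fun x => _)]grad_form_sym.
rewrite !grad_form_subl//.
rewrite [gf v u]grad_form_sym; move: (gf u u) (gf u v) (gf v v) => a b c.
by ring.
Qed.

Lemma diffusion_form_subl i u v w : X u -> X v ->
  A i (fun x => u x - v x) w = A i u w - A i v w.
Proof.
move=> Xu Xv; rewrite (_ : (fun x => _) = fun x => - 1 * v x + u x); last first.
  by apply/funext => x; rewrite mulN1r addrC.
by rewrite /A (diffusion_form_linl hX)// mulN1r addrC.
Qed.

Lemma L2_inner_scale u w : X u -> X w ->
  L2_inner Omega (fun x => eps *: weak_grad Omega u x) (weak_grad Omega w) = eps * gf u w.
Proof.
move=> /(galerkin_H1 hX)/weak_grad_L2 Lu /(galerkin_H1 hX)/weak_grad_L2 Lw.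
(* [L2_inner_linl] expects a multiple plus a second field, hence eps = (eps - 1) + 1. *)
rewrite (_ : (fun x => _) = fun x => (eps - 1) *: weak_grad Omega u x + weak_grad Omega u x).
  by rewrite (L2_inner_linl oO bO)// /grad_form; ring.
by apply/funext => x; rewrite scalerBl scale1r subrK.
Qed.

Lemma potential_eq c phi w : is_potential Q X zeta eps rho0 c phi -> X w ->
  eps * gf phi w = ip (charge c) w.
Proof. by move=> [Xphi h _] Xw; rewrite -h// L2_inner_scale. Qed.

Lemma charge_sub c c' w : ip (charge c) w - ip (charge c') w =
  \sum_i zeta i * (ip (c i) w - ip (c' i) w).
Proof.
rewrite -disc_inner_subl disc_innerE.
under [RHS]eq_bigr do rewrite -disc_inner_subl disc_innerE mulr_sumr.
rewrite exchange_big; apply: eq_bigr => z _ /=.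
have -> : charge c z - charge c' z = \sum_i zeta i * (c i z - c' i z).
  rewrite /charge_density opprD addrACA subrr add0r -sumrB.
  by apply: eq_bigr => i _; rewrite mulrBr.
rewrite mulr_suml mulr_sumr; apply: eq_bigr => i _.
by rewrite -!mulrA mulrCA.
Qed.

Lemma chem_potential_galerkin c phi i : X (mu c phi i).
Proof. exact: interp_galerkin hX _. Qed.

Lemma chem_potentialE c phi i z : z \in nodeset Q ->
  mu c phi i z = ln (c i z) + zeta i * (phi z + phie z).
Proof. by move=> zQ; rewrite /chem_potential (interpE hX). Qed.

Lemma transport_eq c phi i v : sol c phi -> X v ->
  ip (c i) v - ip (cn i) v = - dt * A i (mu c phi i) v.
Proof.
move=> [_ _ tr _] Xv; have := tr v Xv i.
rewrite -disc_inner_subl (_ : ip _ v = dt^-1 * ip (fun x => c i x - cn i x) v); last first.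
  by rewrite !disc_innerE mulr_sumr; apply: eq_bigr => z _; ring.
rewrite -/(diffusion_form _ _ _) -/(A i _ _) => h.
have dt0 : dt != 0 by rewrite gt_eqF.
by rewrite mulNr -mulrN -h mulrA mulfV// mul1r.
Qed.

Lemma solution_gt0 c phi i z : sol c phi -> z \in nodeset Q -> 0 < c i z.
Proof. by move=> [_ lg _ _] zQ; have [s <-] := lg i z zQ; exact: expR_gt0. Qed.

(** The constant 1 is an admissible test function and its discrete gradient is zero. *)
Lemma solution_mass c phi i : sol c phi -> ip (c i) (fun=> 1) = ip (cn i) (fun=> 1).
Proof.
move=> s; have := transport_eq i s (gs_cst hX 1).
rewrite /A diffusion_formC (diffusion_form_cstl hX) mulr0 => /eqP.
by rewrite subr_eq0 => /eqP.
Qed.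

Hypothesis cn_gt0 : forall i z, z \in nodeset Q -> 0 < cn i z.

Lemma diffusion_form_cn_ge0 i u : 0 <= A i u u.
Proof. by apply: diffusion_form_ge0 => z zQ; rewrite mulr_ge0 ?ltW ?cn_gt0. Qed.

(** The Poisson equation turns the electrostatic cross term into eps |grad w|^2, so the tested
    difference is a zero sum of nonnegative terms: entropy [H i], diffusion and electrostatic.
    Vanishing of [H i] identifies the concentrations at the nodes, since ln is strictly increasing;
    the electrostatic term and the zero means identify the potentials. *)
Lemma solution_unique c c' phi phi' : sol c phi -> sol c' phi' ->
  (forall i, {in closure Omega, c i =1 c' i}) /\ {in closure Omega, phi =1 phi'}.
Proof.
move=> s s'.
have [[Xp _ m0] [Xp' _ m0']] := (sol_potential s, sol_potential s').
pose v i := fun x => mu c phi i x - mu c' phi' i x.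
pose w := fun x => phi x - phi' x.
have Xv i : X (v i) by apply: galerkin_sub; exact: chem_potential_galerkin.
have Xw : X w by exact: galerkin_sub.
have tr i : ip (fun x => c i x - c' i x) (v i) = - dt * A i (v i) (v i).
  have := transport_eq i s (Xv i); have := transport_eq i s' (Xv i).
  rewrite disc_inner_subl {3}/v diffusion_form_subl; [|exact: chem_potential_galerkin..].
  lra.
have pot : eps * gf w w = \sum_i zeta i * ip (fun x => c i x - c' i x) w.
  have -> : gf w w = gf phi w - gf phi' w by exact: grad_form_subl.
  have e1 := potential_eq (sol_potential s) Xw.
  have e2 := potential_eq (sol_potential s') Xw.
  rewrite mulrBr [X in X - _]e1 [X in _ - X]e2 charge_sub.
  by apply: eq_bigr => i _; rewrite disc_inner_subl.
pose H i := ip (fun x => c i x - c' i x) (fun x => ln (c i x) - ln (c' i x)).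
have node_ge0 i z : z \in nodeset Q -> 0 <= (c i z - c' i z) * (ln (c i z) - ln (c' i z)).
  move=> zQ; apply: ln_sub_mul_ge0; first exact: (solution_gt0 i s).
  exact: (solution_gt0 i s').
have H0 i : 0 <= H i by apply: disc_inner_ge0 => z; exact: node_ge0.
have split_v i : ip (fun x => c i x - c' i x) (v i) =
    H i + zeta i * ip (fun x => c i x - c' i x) w.
  rewrite /H !disc_innerE mulr_sumr -big_split; apply: eq_big_seq => z zQ /=.
  by rewrite /v !chem_potentialE// /w; ring.
have tot : \sum_i (H i + dt * A i (v i) (v i)) + eps * gf w w = 0.
  rewrite pot -big_split big1// => i _ /=; have := tr i; rewrite split_v; lra.
have dA i : 0 <= dt * A i (v i) (v i) by rewrite mulr_ge0 ?diffusion_form_cn_ge0 ?ltW.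
have gw : 0 <= eps * gf w w by rewrite mulr_ge0 ?grad_form_ge0 ?ltW.
move: tot => /eqP; rewrite paddr_eq0//; last by apply: sumr_ge0 => i _; rewrite addr_ge0.
rewrite psumr_eq0 => [|i _]; last by rewrite addr_ge0.
move=> /andP[/allP HA0]; rewrite mulf_eq0 (gt_eqF heps) /= => /eqP gw0.
split=> [i|x xO].
  have := HA0 i (mem_index_enum i); rewrite paddr_eq0// => /andP[/eqP Hi _].
  apply: (galerkin_nodes_eq hX); [exact: (sol_space s)|exact: (sol_space s')|move=> z zQ].
  apply: ln_sub_mul_eq0; [exact: (solution_gt0 i s)|exact: (solution_gt0 i s')|].
  exact: (disc_inner_eq0 (node_ge0 i) Hi).
have mw : mean (Omega := Omega) w = 0.
  rewrite /w (_ : (fun x => _) = fun x => - 1 * phi' x + phi x); last first.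
    by apply/funext => y; rewrite mulN1r addrC.
  by rewrite (mean_lin hOmega hX)// /mean m0 m0' mulr0 addr0.
by have /eqP := grad_form_mean_eq0 hOmega hX Xw gw0 mw xO; rewrite subr_eq0 => /eqP.
Qed.

Lemma solution_energy c phi : sol c phi ->
  energy Q zeta rho0 phie c phi - energy Q zeta rho0 phie cn phin <=
  - dt * dissipation Q X zeta D phie cn c phi.
Proof.
move=> s; have sp := sol_potential s; have [Xp _ _] := sp; have [Xpn _ _] := hphin.
have -> : - dt * dissipation Q X zeta D phie cn c phi =
    \sum_i (ip (c i) (mu c phi i) - ip (cn i) (mu c phi i)).
  rewrite /dissipation mulr_sumr; apply: eq_bigr => i _.
  by rewrite (transport_eq i s (chem_potential_galerkin _ _ _)).
pose psi x := phi x + phie x.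
have -> : \sum_i (ip (c i) (mu c phi i) - ip (cn i) (mu c phi i)) =
    \sum_i (ip (fun x => c i x - cn i x) (fun x => ln (c i x))) +
    (ip (charge c) psi - ip (charge cn) psi).
  rewrite charge_sub -big_split; apply: eq_bigr => i _ /=.
  rewrite -!disc_inner_subl !disc_innerE mulr_sumr -big_split.
  by apply: eq_big_seq => z zQ /=; rewrite chem_potentialE// /psi; ring.
have ent : \sum_i ip (fun x => c i x * ln (c i x) - c i x) (fun=> 1) -
    \sum_i ip (fun x => cn i x * ln (cn i x) - cn i x) (fun=> 1) <=
    \sum_i (ip (fun x => c i x - cn i x) (fun x => ln (c i x))).
  rewrite -sumrB; apply: ler_sum => i _; rewrite -disc_inner_subl !disc_innerE.
  rewrite big_seq [leRHS]big_seq; apply: ler_sum => z zQ.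
  rewrite ler_pM2l ?node_weight_gt0// mulr1.
  by apply: entropy_convex; [exact: (solution_gt0 i s)|exact: cn_gt0].
have ipD c' u v : ip (charge c') (fun x => 2^-1 * u x + v x) =
    2^-1 * ip (charge c') u + ip (charge c') v.
  by rewrite disc_innerC disc_inner_linl !(disc_innerC _ (charge c')).
have ipsi c' : ip (charge c') psi = ip (charge c') phi + ip (charge c') phie.
  rewrite /psi !disc_innerE -big_split; apply: eq_bigr => z _ /=; ring.
rewrite /energy !ipD !ipsi.
have := potential_eq sp Xp; have := potential_eq hphin Xpn; have := potential_eq hphin Xp.
have := grad_form_ge0 (Omega := Omega) (fun x => phi x - phin x).
rewrite grad_form_sub// [gf phi phin]grad_form_sym => g0 e1 e2 e3.
(* Twice the electrostatic slack in the estimate; by the two Poisson equations it equals eps |grad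
   (phi - phin)|^2. *)
have quad : 0 <= ip (charge c) phi - 2 * ip (charge cn) phi + ip (charge cn) phin.
  have -> : ip (charge c) phi - 2 * ip (charge cn) phi + ip (charge cn) phin =
      eps * (gf phi phi - 2 * gf phin phi + gf phin phin).
    by rewrite -e1 -e2 -e3 mulrDr mulrBr [eps * (2 * _)]mulrCA.
  by apply: mulr_ge0 g0; exact: ltW.
move: quad ent; clear e1 e2 e3 g0.
move: (ip (charge c) phi) (ip (charge cn) phi) (ip (charge cn) phin).
move: (ip (charge c) phie) (ip (charge cn) phie) => p1 p2 p3 p4 p5.
move: (\sum_i _) (\sum_i _) (\sum_i _) => q1 q2 q3.
lra.
Qed.

End pnp.

(** * Existence *)

Section existence.
Context {R : realType} {d : nat} {Omega : set 'rV[R]_d}.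
Context {Q : quadrature Omega} {X : set ('rV[R]_d -> R)}.
Hypotheses (hOmega : bounded_domain Omega) (hX : galerkin_space Q X).
Context {N : nat} {zeta D : 'I_N -> R} {eps rho0 : R} {phie : 'rV[R]_d -> R} {dt : R}.
Hypotheses (hD : forall i, 0 < D i) (heps : 0 < eps) (hdt : 0 < dt).
Context {cn : 'I_N -> 'rV[R]_d -> R} {phin : 'rV[R]_d -> R}.
Hypothesis hphin : is_potential Q X zeta eps rho0 cn phin.
Hypothesis cn_gt0 : forall i z, z \in nodeset Q -> 0 < cn i z.
Implicit Types (u v w phi : 'rV[R]_d -> R) (c : 'I_N -> 'rV[R]_d -> R).

Local Notation sol := (is_solution Q X zeta D eps rho0 phie dt cn).
Local Notation mu := (chem_potential Q X zeta phie).
Local Notation ip := (disc_inner Q).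
Local Notation gf := (grad_form (Omega := Omega)).
Local Notation charge := (charge_density zeta rho0).
Local Notation mean := (mean (Omega := Omega)).
Local Notation nw := (node_weight (Q := Q)).
Local Notation T := {ffun nodeset Q -> R^o}.

Let A i := diffusion_form (Q := Q) (fun z => D i * cn i z).

(** Members of [X] are functions on the whole space, relevant only on the closure of the domain;
    nodal values give a genuine finite-dimensional vector space in their place. [interp] evaluates
    at nodes only, where [insub] succeeds, so the default 0 is never read. *)
Definition extend (f : T) : 'rV[R]_d -> R := interp Q X (fun z => oapp f 0 (insub z)).

Lemma extend_galerkin f : X (extend f).
Proof. exact: interp_galerkin hX _. Qed.

Lemma extendE (f : T) (z : nodeset Q) : extend f (val z) = f z.
Proof. by rewrite /extend (interpE hX) ?(valP z)// valK. Qed.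

Lemma extend_lin a f g : extend (a *: f + g) = fun x => a * extend f x + extend g x.
Proof.
rewrite /extend -interp_lin; apply: eq_interp => z zQ.
by rewrite insubT /= !ffunE.
Qed.

Definition restrict_nodes u : T := [ffun z => u (val z)].

Lemma extendK u : X u -> {in closure Omega, extend (restrict_nodes u) =1 u}.
Proof.
move=> Xu; apply: (galerkin_nodes_eq hX) => //; first exact: extend_galerkin.
by move=> z zQ; have := extendE (restrict_nodes u) [` zQ]%fset; rewrite ffunE.
Qed.

Let V : vectType R := ({ffun 'I_N -> T} * T)%type.
Let K := ('I_N * nodeset Q)%type.

(* An unknown (m, chi) of V stands for the chemical potentials extend (m i) and
   the potential phin + extend chi. The product of means in B fixes the additive
   constant of the potential; being zero at the minimizer, it does not perturb
   the Poisson equation. *)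
Let l (k : K) (y : V) : R := y.1 k.1 k.2 - zeta k.1 * y.2 k.2.
Let B (y y' : V) : R :=
  dt * (\sum_i A i (extend (y.1 i)) (extend (y'.1 i))) +
  eps * gf (extend y.2) (extend y'.2) + mean (extend y.2) * mean (extend y'.2).

Let l_form k : linear_form (l k).
Proof. by move=> a x y; rewrite /l /= !ffunE /= /GRing.scale/=; ring. Qed.

Let Bsym x y : B x y = B y x.
Proof.
rewrite /B grad_form_sym [mean _ * _]mulrC; congr (_ * _ + _ + _).
by apply: eq_bigr => i _; exact: diffusion_formC.
Qed.

Let B_form y : linear_form (B ^~ y).
Proof.
move=> a u v; rewrite /B /= extend_lin (mean_lin hOmega hX); [|exact: extend_galerkin..].
rewrite grad_form_linl; try (by case: hOmega); try exact/(galerkin_H1 hX)/extend_galerkin.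
have -> : \sum_i A i (extend ((a *: u + v).1 i)) (extend (y.1 i)) =
    a * (\sum_i A i (extend (u.1 i)) (extend (y.1 i))) +
    \sum_i A i (extend (v.1 i)) (extend (y.1 i)).
  rewrite mulr_sumr -big_split; apply: eq_bigr => i _ /=.
  rewrite !ffunE extend_lin /A (diffusion_form_linl hX)//; exact: extend_galerkin.
move: (\sum_i _) (\sum_i _) (gf _ _) (gf _ _) (mean _) (mean _) (mean _).
move=> q1 q2 q3 q4 q5 q6 q7.
by ring.
Qed.

Let B_ge0 x : 0 <= B x x.
Proof.
rewrite /B !addr_ge0//.
- by rewrite mulr_ge0 ?(ltW hdt)//; apply: sumr_ge0 => i _; exact: (diffusion_form_cn_ge0 hD cn_gt0).
- by rewrite mulr_ge0 ?(ltW heps) ?grad_form_ge0.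
- by rewrite -expr2 sqr_ge0.
Qed.

(** Zero Dirichlet form and zero mean give chi = 0; the forms [l] then reduce to the nodal values of
    the chemical potentials. *)
Let B_nondegenerate x : (forall k, l k x = 0) -> B x x = 0 -> x = 0.
Proof.
have p1 : 0 <= dt * (\sum_i A i (extend (x.1 i)) (extend (x.1 i))).
  by rewrite mulr_ge0 ?(ltW hdt)//; apply: sumr_ge0 => i _; exact: (diffusion_form_cn_ge0 hD cn_gt0).
have p2 : 0 <= eps * gf (extend x.2) (extend x.2).
  by rewrite mulr_ge0 ?(ltW heps) ?grad_form_ge0.
move=> lx /eqP; rewrite /B paddr_eq0 ?addr_ge0// -?expr2 ?sqr_ge0//.
rewrite paddr_eq0// => /andP[/andP[_]].
rewrite mulf_eq0 (gt_eqF heps)/= => /eqP g0; rewrite sqrf_eq0 => /eqP m0.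
have x20 z : x.2 z = 0.
  rewrite -extendE; apply: (grad_form_mean_eq0 hOmega hX (extend_galerkin _) g0 m0).
  by rewrite inE; apply: node_closure; exact: valP.
rewrite [x]surjective_pairing; congr pair; last by apply/ffunP => z; rewrite x20 ffunE.
apply/ffunP => i; apply/ffunP => z; rewrite !ffunE.
by have := lx (i, z); rewrite /l/= x20 mulr0 subr0.
Qed.

Lemma extend0 : extend 0 = fun=> 0.
Proof.
apply/funext => x; rewrite /extend /interp big1// => z _.
by case: insubP => [y _ _|_] /=; rewrite ?ffunE mul0r.
Qed.

Lemma disc_inner_nodes u (h : T) :
  ip u (extend h) = \sum_(z : nodeset Q) nw (val z) * (u (val z) * h z).
Proof.
by rewrite disc_innerE big_seq_fsetE; apply: eq_bigr => z _; rewrite extendE.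
Qed.

Lemma disc_inner_restrict u v : ip u (extend (restrict_nodes v)) = ip u v.
Proof.
by rewrite disc_inner_nodes disc_innerE big_seq_fsetE; apply: eq_bigr => z _; rewrite ffunE.
Qed.

(** The stationarity equation with weights [node_weight] and slopes [cn], the exponentials being
    read as nodal concentrations. The subtracted sum comes from the part - zeta chi of [l]. *)
Lemma dual_equation : exists (y : V) c,
  [/\ forall i, X (c i),
      forall i (z : nodeset Q),
        c i (val z) = expR (l (i, z) y - zeta i * (phin (val z) + phie (val z))) &
      forall h : V, \sum_i (ip (c i) (extend (h.1 i)) - ip (cn i) (extend (h.1 i))) -
        \sum_i zeta i * (ip (c i) (extend h.2) - ip (cn i) (extend h.2)) + B y h = 0].
Proof.
pose e (k : K) := - (zeta k.1 * (phin (val k.2) + phie (val k.2))).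
have b0 (k : K) : 0 < nw (val k.2) by apply: node_weight_gt0; exact: valP.
have c0 (k : K) : 0 < cn k.1 (val k.2) by apply: cn_gt0; exact: valP.
have [y hy] := exp_form_equation e b0 c0 l_form B_form Bsym B_ge0 B_nondegenerate.
pose c i := extend [ffun z => expR (l (i, z) y + e (i, z))].
have cE i (z : nodeset Q) : c i (val z) = expR (l (i, z) y + e (i, z)).
  by rewrite /c extendE ffunE.
exists y, c; split=> [i|i z|h]; [exact: extend_galerkin|exact: cE|].
rewrite -[RHS](hy h); congr (_ + _).
rewrite -sumrB (eq_bigr (fun k : K => nw (val k.2) *
  (c k.1 (val k.2) - cn k.1 (val k.2)) * l k h)); last first.
  by move=> [i z] _; rewrite cE.
rewrite -(pair_bigA _ (fun i (z : nodeset Q) => nw (val z) *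
  (c i (val z) - cn i (val z)) * l (i, z) h))/=.
apply: eq_bigr => i _; rewrite -!disc_inner_subl !disc_inner_nodes mulr_sumr -sumrB.
by apply: eq_bigr => z _; rewrite /l/=; ring.
Qed.

Lemma solution_exists : exists c phi, sol c phi.
Proof.
have [y [c [Xc cE hE]]] := dual_equation.
pose chi := extend y.2.
have Xchi : X chi by exact: extend_galerkin.
(* The factor 1 gives the shape a * u + v that the linearity lemmas match. *)
pose phi x := 1 * phin x + chi x.
have [Xpn _ mpn] := hphin.
have Xphi : X phi by exact: (gs_lin hX).
(* The logarithm undoes the exponential, and zeta (phi + phie) cancels the shift stored in [l] and
   in the data. *)
have muE i : mu c phi i = extend (y.1 i).
  apply: eq_interp => z zQ; rewrite insubT /=.
  have cz := cE i [` zQ]%fset; have xz := extendE y.2 [` zQ]%fset.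
  rewrite /= in cz xz; rewrite cz expRK /phi /chi xz /l/= mul1r.
  by ring.
have XH1 u (Xu : X u) : H1 Omega u := galerkin_H1 hX Xu.
have [oO _ _ bO] := hOmega.
have gf_cst u k : X u -> gf u (fun=> k) = 0.
  by move=> Xu; rewrite grad_form_sym (grad_form_cstl oO bO)//; exact: XH1.
have A_cst i u k : A i u (fun=> k) = 0.
  by rewrite /A diffusion_formC (diffusion_form_cstl hX).
have ip0 u : ip u (fun=> 0) = 0 by rewrite disc_innerE big1// => z _; rewrite !mulr0.
have mean0 : mean (fun=> 0) = 0.
  by rewrite /mean Rintegral_cst ?mul0r//; exact: open_rV_measurable.
(* Test along m_i += zeta_i, chi += 1, which changes no concentration. *)
have mchi : mean chi = 0.
  have := hE ([ffun i => restrict_nodes (fun=> zeta i)], restrict_nodes (fun=> 1)).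
  have Xr k : X (extend (restrict_nodes (fun=> k))) by exact: extend_galerkin.
  have rK k := extendK (gs_cst hX k).
  rewrite (_ : \sum_i _ - \sum_i _ = 0) ?add0r; last first.
    rewrite -sumrB big1// => i _; rewrite /= ffunE !disc_inner_restrict !disc_innerE.
    by rewrite -!sumrB mulr_sumr -sumrB big1// => z _; ring.
  rewrite /B/= big1 ?mulr0 ?add0r => [|i _]; last first.
    rewrite ffunE -[RHS](A_cst i (extend (y.1 i)) (zeta i)).
    apply: (eq_diffusion_form hX) => //; try exact: extend_galerkin.
    exact: (gs_cst hX).
  have -> : gf (extend y.2) (extend (restrict_nodes (fun=> 1))) = 0.
    transitivity (gf chi (fun=> 1)); last exact: gf_cst.
    by apply: eq_grad_form; [by []|exact: rK].
  rewrite mulr0 add0r => /eqP; rewrite mulf_eq0 => /orP[/eqP//|/eqP m1].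
  have := mean_constant hOmega (rK 1) m1.
  by move=> /eqP; rewrite oner_eq0.
exists c, phi; split => //.
- move=> i z zQ; exists (l (i, [` zQ]%fset) y - zeta i * (phin z + phie z)).
  by rewrite -cE.
- move=> v Xv i.
  (* Varying the i-th chemical potential alone isolates the i-th transport equation. *)
  have := hE ([ffun k => if k == i then restrict_nodes v else 0], 0).
  rewrite /B /= extend0 mean0 gf_cst// !mulr0 !addr0.
  rewrite [X in _ - X]big1 ?subr0 => [|k _]; last by rewrite !ip0 subrr mulr0.
  rewrite (bigD1 i)//= big1 ?addr0 => [|k /negbTE ki]; last first.
    by rewrite ffunE ki extend0 !ip0 subrr.
  rewrite (bigD1 i)//= [X in _ * (_ + X)]big1 ?addr0 => [|k /negbTE ki]; last first.
    by rewrite ffunE ki extend0 A_cst.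
  rewrite ffunE eqxx !disc_inner_restrict muE.
  have -> : A i (extend (y.1 i)) (extend (restrict_nodes v)) = A i (extend (y.1 i)) v.
    by apply: (eq_diffusion_form hX) => //; [exact: extend_galerkin..|exact: extendK].
  move=> /eqP; rewrite -disc_inner_subl addr_eq0 => /eqP h.
  have -> : ip (fun x => (c i x - cn i x) / dt) v = ip (fun x => c i x - cn i x) v / dt.
    by rewrite !disc_innerE mulr_suml; apply: eq_bigr => z _; ring.
  by rewrite h -mulNr mulrC mulrA mulrN mulVf ?mulN1r// gt_eqF.
- split=> //; last first.
    rewrite -[LHS]/(mean phi) (mean_lin hOmega hX)// mchi addr0 mul1r; exact: mpn.
  move=> w Xw; rewrite (L2_inner_scale hOmega hX)// grad_form_linl ?mul1r;
    [|by []|by []|exact: XH1..].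
  (* Varying the potential alone gives the Poisson equation for [chi], with the change of charge as
     source; adding that of [phin] restores the full charge. *)
  have := hE (0, restrict_nodes w).
  rewrite /B /= -/chi mchi mul0r addr0.
  rewrite big1 ?sub0r => [|i _]; last by rewrite ffunE extend0 !ip0 subrr.
  rewrite [X in dt * X]big1 ?mulr0 ?add0r => [|i _]; last by rewrite ffunE extend0 A_cst.
  have -> : gf chi (extend (restrict_nodes w)) = gf chi w.
    by apply: eq_grad_form => //; exact: extendK.
  under eq_bigr do rewrite !disc_inner_restrict.
  have <- : ip (charge c) w - ip (charge cn) w =
      \sum_i zeta i * (ip (c i) w - ip (cn i) w) by exact: charge_sub.
  have e := potential_eq hOmega hX hphin Xw.
  rewrite mulrDr [X in _ -> X + _ = _]e.
  by move=> /eqP; rewrite addrC subr_eq0 => /eqP ->; rewrite addrC subrK.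
Qed.

End existence.

Unset Implicit Arguments.

Theorem theorem3p2 (R : realType) (d : nat) (hd : (0 < d <= 3)%N)
  (Omega : set 'rV[R]_d) (hOmega : bounded_domain Omega)
  (Q : quadrature Omega)
  (X : set ('rV[R]_d -> R)) (hX : galerkin_space Q X)
  (N : nat) (hN : (0 < N)%N)
  (zeta D : 'I_N -> R) (hD : forall i, 0 < D i)
  (eps : R) (heps : 0 < eps) (rho0 : R)
  (phie : 'rV[R]_d -> R) (hphie : {within closure Omega, continuous phie})
  (dt : R) (hdt : 0 < dt)
  (cn : 'I_N -> 'rV[R]_d -> R) (hcn : forall i, X (cn i))
  (hneutral : disc_inner Q (charge_density zeta rho0 cn) (fun=> 1) = 0)
  (phin : 'rV[R]_d -> R)
  (hphin : is_potential Q X zeta eps rho0 cn phin) :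
  (forall c phi, is_solution Q X zeta D eps rho0 phie dt cn c phi ->
     forall i, disc_inner Q (c i) (fun=> 1) = disc_inner Q (cn i) (fun=> 1)) /\
  ((forall i z, z \in nodeset Q -> 0 < cn i z) ->
   [/\ exists c phi,
         is_solution Q X zeta D eps rho0 phie dt cn c phi /\
         forall c' phi',
           is_solution Q X zeta D eps rho0 phie dt cn c' phi' ->
           (forall i, {in closure Omega, c i =1 c' i}) /\
           {in closure Omega, phi =1 phi'},
       forall c phi, is_solution Q X zeta D eps rho0 phie dt cn c phi ->
         forall i z, z \in nodeset Q -> 0 < c i z
     & forall c phi, is_solution Q X zeta D eps rho0 phie dt cn c phi ->
         energy Q zeta rho0 phie c phi - energy Q zeta rho0 phie cn phin <=
         - dt * dissipation Q X zeta D phie cn c phi]).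
Proof.
split=> [c phi s i|cn0]; first exact: (solution_mass hX hdt i s).
split=> [|c phi s i z zQ|c phi s].
- have [c [phi s]] :=
    solution_exists (phie := phie) hOmega hX hD heps hdt hphin cn0.
  exists c, phi; split=> // c' phi' s'.
  exact: (solution_unique hOmega hX hD heps hdt cn0 s s').
- exact: (solution_gt0 i s zQ).
- exact: (solution_energy hOmega hX heps hdt hphin cn0 s).
Qed.
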